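(* There exists an absolute constant $A>0$ such that for every $\beta>0$ there exists $C>0$ such that for $p=p(n)\ge\frac Cn$, with high probability $G(n,p)\to_2\mathcal C$, where $\mathcal C=\{C_t\mid A\log n\le t\le(\frac23-\beta)n,\ t\text{ is even}\}$. In particular, with high probability $G(n,p)\to_2C_{\lfloor(\frac23-\beta)n\rfloor_{even}}$.
   Context: $G(n,p)$ is the binomial random graph on $\{1,\dots,n\}$ with each pair an edge independently with probability $p$. ''With high probability'' means with probability tending to $1$ as $n\to\infty$. $C_t$ is the cycle of length $t$ (with $t$ edges); $\log$ is the natural logarithm. $\lfloor\ell\rfloor_{even}$ is the largest even integer $m\le\ell$. For graphs $G,H$, $G\to_rH$ means that every $r$-coloring of the edges of $G$ contains a monochromatic copy of $H$. For a family $\mathcal H$ of graphs, $G\to_r\mathcal H$ means that for every $r$-coloring of the edges of $G$ there exists a color $i$ such that there is a monochromatic copy of every $H\in\mathcal H$ in color $i$. The number $\beta$ in the ''in particular'' part is understood to be small enough that the cycle length is meaningful ($\beta<\frac23$). *)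

(* Defs.v *)
From HB Require Import structures.
From mathcomp Require Import all_boot all_order all_algebra.
From mathcomp Require Import all_classical all_reals all_analysis.

Set Implicit Arguments.
Unset Strict Implicit.
Unset Printing Implicit Defensive.

Import Order.TTheory GRing.Theory Num.Theory.
Import numFieldNormedType.Exports.

Local Open Scope ring_scope.

Definition pairs (V : finType) : {set {set V}} :=
  [set e : {set V} | #|e| == 2%N].

Record graph := Graph {
  vertex :> finType;
  edges : {set {set vertex}};
  edges_pairs : edges \subset pairs vertex
}.

Definition graph_of_pairs (V : finType) (E : {set {set V}}) : graph :=
  Graph (subsetIr E (pairs V)).

(* This is C_t for t >= 3; for t < 3, degenerate edges are discarded by
   graph_of_pairs. *)
Definition cycle_graph (t : nat) : graph :=
  graph_of_pairs [set [set i; ordS i] | i : 'I_t].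

(* Colorings of the edges of G are total functions on {set G}; only their
   values on edges G are ever used. *)
Definition mono_copy (r : nat) (G H : graph) (c : {set G} -> 'I_r) (i : 'I_r)
    : Prop :=
  exists f : H -> G, injective f /\
    forall e, e \in edges H -> f @: e \in edges G /\ c (f @: e) = i.

Definition arrows (r : nat) (G H : graph) : Prop :=
  forall c : {set G} -> 'I_r, exists i : 'I_r, mono_copy H c i.

(* The color i is chosen before H: it is the same for the whole family. *)
Definition arrows_family (r : nat) (G : graph) (Hs : graph -> Prop) : Prop :=
  forall c : {set G} -> 'I_r, exists i : 'I_r,
    forall H, Hs H -> mono_copy H c i.

(* Law of G(n,p): a set E of pairs has weight the product over all pairs e of
   p or 1 - p, according to whether e is in E. The vertex set is {0,...,n-1}. *)
Definition gnp_weight (R : realType) (n : nat) (p : R)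
    (E : {set {set 'I_n}}) : R :=
  \prod_(e in pairs 'I_n) (if e \in E then p else 1 - p).

Definition gnp_prob (R : realType) (n : nat) (p : R) (Q : graph -> Prop) : R :=
  \sum_(E : {set {set 'I_n}} | (E \subset pairs 'I_n)
                               && `[< Q (graph_of_pairs E) >])
    gnp_weight p E.

Definition whp (R : realType) (p : nat -> R) (Q : nat -> graph -> Prop)
    : Prop :=
  ((fun n : nat => gnp_prob n (p n) (Q n)) @ \oo --> (1 : R))%classic.

(* The largest even integer m <= l, for l >= 0. *)
Definition floor_even (R : realType) (l : R) : nat :=
  \max_(m < (Num.truncn l).+1 | ~~ odd m && (m%:R <= l)) m.

Lemma floor_evenP (R : realType) (l : R) : 0 <= l ->
  [/\ ~~ odd (floor_even l), (floor_even l)%:R <= l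
    & forall m : nat, ~~ odd m -> m%:R <= l -> (m <= floor_even l)%N].
Proof.
move=> l0; split; last first.
- move=> m om ml; have mt : (m < (Num.truncn l).+1)%N.
    by rewrite ltnS truncn_ge_nat.
  rewrite /floor_even.
  by apply: (@leq_bigmax_cond _ _ (fun i : 'I_(Num.truncn l).+1 => i : nat)
    (Ordinal mt)); rewrite /= om ml.
- rewrite /floor_even.
  by elim/big_ind: _ => // [x y hx hy|i /andP[]//]; rewrite /maxn; case: ifP.
- rewrite /floor_even.
  by elim/big_ind: _ => // [x y hx hy|i /andP[]//]; rewrite /maxn; case: ifP.
Qed.

Definition even_cycles (R : realType) (a b : R) (H : graph) : Prop :=
  exists t : nat, [/\ a <= t%:R, t%:R <= b, ~~ odd t & H = cycle_graph t].

(* Main.v *)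
Require Import Defs.
From mathcomp Require Import all_boot zify.

Set Implicit Arguments.
Unset Strict Implicit.
Unset Printing Implicit Defensive.

(** The only property of G(n,p) that is used is that any two disjoint sets of
    at least n/G vertices span an edge; a first moment computation gives it.

    Fix a 2-coloring.  Call a pair of vertex classes joined in a color if any
    two subsets of relative size 1/Q span an edge of this color.  If the red
    graph has a hole in a pair, the hole itself is a pair without red edges.
    Hence a partition in which many pairs are neither red-joined nor free of
    red edges can be refined so as to increase the mass of the pairs without
    red edges, and after boundedly many refinements almost all pairs are joined
    in one of the colors.

    The reduced graph on the classes is almost complete, so one color has an
    almost spanning component.  A maximum matching of this component either
    covers almost 2/3 of the classes, or its unmatched classes together with
    one endpoint of each edge carry such a matching in the other color.

    In a joined pair depth-first search yields almost spanning paths, and some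
    vertex reaches linearly many vertices at one fixed logarithmic distance.
    Paths in the matched pairs are linked through the component into a long
    path Q that starts and ends in the same pair; a root u outside Q with two
    disjoint branches of depths h1 and h2 closes a segment of Q of any
    prescribed length in the right parity class into a cycle.  Restricting all
    the edges to those changing a phase makes the structure bipartite, which
    takes care of parity. *)

(** * Holes and partitions into joined pairs *)

(** The threshold [s] is an absolute number of vertices; for classes of size [m] it will be
    [m %/ Q]. *)
Definition joined (V : finType) (e : rel V) (s : nat) (A B : {set V}) : bool :=
  [forall X : {set V}, forall Y : {set V},
    [&& X \subset A, Y \subset B, s <= #|X| & s <= #|Y|] ==>
    [exists x in X, exists y in Y, e x y]].

Lemma joinedP (V : finType) (e : rel V) (s : nat) (A B : {set V}) :
  reflect (forall X Y : {set V}, X \subset A -> Y \subset B ->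
             s <= #|X| -> s <= #|Y| ->
             exists x y, [/\ x \in X, y \in Y & e x y])
          (joined e s A B).
Proof.
apply: (iffP forallP) => [h X Y XA YB sX sY|h X].
  have /forallP/(_ Y)/implyP := h X.
  rewrite XA YB sX sY => /(_ isT)/exists_inP[x xX /exists_inP[y yY exy]].
  by exists x, y.
apply/forallP => Y; apply/implyP => /and4P[XA YB sX sY].
have [x [y [xX yY exy]]] := h X Y XA YB sX sY.
by apply/exists_inP; exists x => //; apply/exists_inP; exists y.
Qed.

Lemma joined_sub (V : finType) (e : rel V) (s : nat) (A B A' B' : {set V}) :
  A' \subset A -> B' \subset B -> joined e s A B -> joined e s A' B'.
Proof.
move=> hA hB /joinedP h; apply/joinedP => X Y hX hY.
exact: h (subset_trans hX hA) (subset_trans hY hB).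
Qed.

Lemma joined_sym (V : finType) (e : rel V) (s : nat) (A B : {set V}) :
  symmetric e -> joined e s A B -> joined e s B A.
Proof.
move=> se /joinedP h; apply/joinedP => X Y hX hY sX sY.
have [y [x [yY xX eyx]]] := h Y X hY hX sY sX.
by exists x, y; split=> //; rewrite se.
Qed.

(** The vertices of [Y] missed by [X] form with [X] a pair without edges. In this one-sided form
    joinedness yields expansion. *)
Lemma joined_miss (V : finType) (e : rel V) (s : nat) (A B X Y : {set V}) :
  joined e s A B -> X \subset A -> Y \subset B -> s <= #|X| ->
  #|[set y in Y | [forall x in X, ~~ e x y]]| < s.
Proof.
move=> /joinedP h XA YB sX; rewrite ltnNge; apply/negP => sY.
have sub : [set y in Y | [forall x in X, ~~ e x y]] \subset B.
  by apply: subset_trans YB; apply/subsetP => y; rewrite inE => /andP[].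
have [x [y [xX]]] := h X _ XA sub sX sY.
by rewrite inE => /andP[_ /forall_inP/(_ x xX)/negbTE->].
Qed.

(** [A] is cut along [enum A] into consecutive blocks of [m] vertices, the last one possibly
    shorter. The value is meaningful only for [v] in [A]. *)
Definition chunk (V : finType) (m : nat) (A : {set V}) (v : V) : nat :=
  index v (enum A) %/ m.

Lemma card_chunk (V : finType) (m : nat) (A : {set V}) (j : nat) : 0 < m ->
  #|[set v in A | chunk m A v == j]| = minn m (#|A| - j * m).
Proof.
move=> m0.
have -> : #|[set v in A | chunk m A v == j]|
    = count (fun i => i %/ m == j) (iota 0 #|A|).
  have -> : iota 0 #|A| = [seq index v (enum A) | v <- enum A].
    rewrite cardE; apply: (@eq_from_nth _ 0); rewrite ?size_map ?size_iota //.
    move=> i hi; rewrite nth_iota // add0n.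
    have v0 : V by case: (enum A) hi.
    by rewrite (nth_map v0) // index_uniq // enum_uniq.
  rewrite count_map -sum1_count big_enum_cond -sum1_card.
  by apply: eq_bigl => v; rewrite inE.
elim: #|A| => [|N IH]; first by rewrite /= sub0n minn0.
rewrite -{1}[N.+1]addn1 iotaD add0n count_cat {}IH /= addn0.
have -> : (N %/ m == j) = (j * m <= N < j * m + m).
  by rewrite eqn_leq andbC leq_divRL // -[X in _ && X]ltnS ltn_divLR // mulSn addnC.
by case: (boolP (j * m <= N < j * m + m)) => h /=; move: h;
   move: (j * m) => jm; lia.
Qed.

(** * Classes of a labelling, pairs without edges and their mass *)

Definition cls (V T : finType) (f : V -> T) (a : T) : {set V} :=
  [set v | f v == a].

Lemma card_cls_cover (V T : finType) (g : V -> T) (L : {set T}) (m : nat) :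
  (forall l, l \in L -> #|cls g l| = m) ->
  #|V| <= #|L| * m + #|[set v | g v \notin L]|.
Proof.
move=> hL; rewrite -(cardC [set v | g v \notin L]) addnC leq_add2r.
rewrite -[X in X <= _]sum1_card (partition_big g (mem L)) /=; last first.
  by move=> v; rewrite !inE negbK.
rewrite -sum_nat_const; apply: leq_sum => l /hL <-; rewrite sum1_card.
by apply: subset_leq_card; apply/subsetP => v /andP[_ gl]; rewrite inE.
Qed.

Definition pure (V T : finType) (e : rel V) (f : V -> T) (a b : T) : bool :=
  [forall x in cls f a, forall y in cls f b, ~~ e x y].

Lemma pureP (V T : finType) (e : rel V) (f : V -> T) (a b : T) :
  reflect (forall x y, f x = a -> f y = b -> ~~ e x y) (pure e f a b).
Proof.
apply: (iffP forall_inP) => [h x y xa yb|h x].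
  have xA : x \in cls f a by rewrite inE xa.
  by apply: (forall_inP (h x xA)); rewrite inE yb.
by rewrite inE => /eqP xa; apply/forall_inP => y; rewrite inE => /eqP; apply: h.
Qed.

(** The potential of the refinement argument. Counting pairs of vertices and not of classes makes it
    comparable across different label sets and bounds it by [#|V| ^ 2]. *)
Definition pure_mass (V T : finType) (e : rel V) (f : V -> T) : nat :=
  #|[set xy : V * V | pure e f (f xy.1) (f xy.2)]|.

Lemma pure_mass_refine (V T U : finType) (e : rel V) (f : V -> T) (g : V -> U) :
  (forall x y, g x = g y -> f x = f y) -> pure_mass e f <= pure_mass e g.
Proof.
move=> fg; apply: subset_leq_card; apply/subsetP => -[x y].
rewrite !inE /= => /pureP h; apply/pureP => x' y' /fg h1 /fg h2; exact: h.
Qed.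

(** For every pair of classes that has the class of [v] as first or second entry, the label records
    whether [v] lies in the corresponding side of the hole. *)
Definition refine_by (V T : finType) (g : V -> T) (X Y : T -> T -> {set V})
    (v : V) : T * {ffun T -> bool} * {ffun T -> bool} :=
  (g v, [ffun b => v \in X (g v) b], [ffun a => v \in Y a (g v)]).

(** The rectangles [X a b] times [Y a b], for [(a, b)] in [B], lie in different products of classes.
    Their vertex pairs were not pure before, as [(a, b)] was not, and become pure because the new
    labels separate each hole from the rest. *)
Lemma pure_mass_refine_by (V T : finType) (e : rel V) (g : V -> T)
    (X Y : T -> T -> {set V}) (B : {set T * T}) (s : nat) :
  (forall a b, (a, b) \in B -> [/\ ~~ pure e g a b, X a b \subset cls g a,
      Y a b \subset cls g b & s <= #|X a b|] /\ s <= #|Y a b| /\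
      (forall x y, x \in X a b -> y \in Y a b -> ~~ e x y)) ->
  pure_mass e g + #|B| * (s * s) <= pure_mass e (refine_by g X Y).
Proof.
move=> hB.
set Z := [set xy : V * V | [&& (g xy.1, g xy.2) \in B,
  xy.1 \in X (g xy.1) (g xy.2) & xy.2 \in Y (g xy.1) (g xy.2)]].
have cZ : #|B| * (s * s) <= #|Z|.
  rewrite -[#|Z|]sum1_card (partition_big (fun xy => (g xy.1, g xy.2)) (mem B)) /=.
    rewrite -sum_nat_const; apply: leq_sum => -[a b] abB.
    have [[_ Xa Yb sX] [sY _]] := hB a b abB.
    rewrite sum1_card; apply: leq_trans (leq_mul sX sY) _; rewrite -cardsX.
    apply: subset_leq_card; apply/subsetP => -[x y] /setXP[/= xX yY].
    have := subsetP Xa x xX; have := subsetP Yb y yY.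
    rewrite !inE => /eqP gy /eqP gx.
    by rewrite unfold_in /= inE /= gx gy abB xX yY eqxx.
  by move=> [x y]; rewrite inE => /and3P[].
apply: leq_trans (leq_add (leqnn _) cZ) _; rewrite /pure_mass -cardsUI.
rewrite [X in _ + X](_ : _ = 0) ?addn0; last first.
  apply: eq_card0 => -[x y]; rewrite !inE /=; apply/negP => /and4P[h xyB _ _].
  by have [[/negP] ] := hB _ _ xyB.
apply: subset_leq_card; apply/subsetP => -[x y]; rewrite !inE /=.
case/orP => [/pureP h|/and3P[xyB xX yY]].
  by apply/pureP => x' y' [h1 _ _] [h2 _ _]; apply: h.
have [_ [_ h]] := hB _ _ xyB; apply/pureP => x' y' [gx' /ffunP ex _] [gy' _ /ffunP ey].
apply: h.
  by have := ex (g y); rewrite !ffunE gx' => ->.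
by have := ey (g x); rewrite !ffunE gy' => ->.
Qed.

(** The square [Q ^ 2] leaves one factor [Q] for the fraction of labels dropped by averaging and one
    for the fraction of bad partners of each remaining label. *)
Definition clustering (V T : finType) (e : rel V) (Q m s : nat) (g : V -> T)
    (L : {set T}) : Prop :=
  [/\ forall l, l \in L -> #|cls g l| = m,
      Q * #|[set v | g v \notin L]| <= #|V|
    & Q ^ 2 * #|[set p : T * T | [&& p.1 \in L, p.2 \in L, ~~ pure e g p.1 p.2
        & ~~ joined e s (cls g p.1) (cls g p.2)]]| <= #|L| ^ 2].

Definition chunk_labels (Q K : nat) : nat := K * (2 * Q * K).+1.

(** A chunk label together with two Boolean functions on the chunk labels, as in [refine_by]. *)
Definition next_labels (Q K : nat) : nat :=
  chunk_labels Q K * 2 ^ chunk_labels Q K * 2 ^ chunk_labels Q K.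

(* Either the chunks of the classes of f form a clustering, or recording the
   holes of all the bad pairs of chunks increases the mass of pure pairs. *)
Lemma clustering_step (V T : finType) (e : rel V) (Q D : nat) (f : V -> T) :
  1 < Q -> 0 < D -> 0 < #|T| -> Q * #|T| * D <= #|V| ->
  let m := #|V| %/ (Q * #|T|) in
  (exists (g : V -> T * 'I_(2 * Q * #|T|).+1) (L : {set _}),
      clustering e Q m (m %/ D) g L) \/
  (exists (U : finType) (h : V -> U), #|U| = next_labels Q #|T| /\
     16 * Q ^ 2 * D ^ 2 * pure_mass e f + #|V| ^ 2 <=
     16 * Q ^ 2 * D ^ 2 * pure_mass e h).
Proof.
move=> Q1 D0 T0 bigV m.
have mD : D <= m by rewrite /m leq_divRL ?muln_gt0 ?T0 ?(ltnW Q1) // mulnC.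
have m0 : 0 < m by apply: leq_trans mD.
(* This keeps every chunk number within the ordinal type, so that [inord] below is faithful. *)
have V_lt : #|V| < (2 * Q * #|T|).+1 * m.
  have := ltn_ceil #|V| (_ : 0 < Q * #|T|); rewrite muln_gt0 T0 (ltnW Q1) -/m.
  by move=> /(_ isT); nia.
have chunk_lt a v : v \in cls f a -> chunk m (cls f a) v < (2 * Q * #|T|).+1.
  move=> va; rewrite /chunk ltn_divLR //; apply: leq_trans V_lt; rewrite ltnS.
  by apply: leq_trans (max_card (mem (cls f a))); rewrite ltnW // cardE index_mem mem_enum.
pose g v : T * 'I_(2 * Q * #|T|).+1 := (f v, inord (chunk m (cls f (f v)) v)).
have in_cls v : v \in cls f (f v) by rewrite inE.
have clsg a j : cls g (a, j) = [set v in cls f a | chunk m (cls f a) v == j].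
  apply/setP => v; rewrite !inE xpair_eqE; case: eqP => //= <-.
  by rewrite -val_eqE /= inordK // chunk_lt.
have card_clsg a j : #|cls g (a, j)| = minn m (#|cls f a| - j * m).
  by rewrite clsg card_chunk.
pose L := [set l | #|cls g l| == m].
have hL l : l \in L -> #|cls g l| = m by rewrite inE => /eqP.
(* Only the last, incomplete chunk of a class is lost; by the choice of [m] these leftovers add up
   to at most a [1/Q] fraction of [V]. *)
have left a : #|[set v | (f v == a) && (g v \notin L)]| <= m.
  have: minn m (#|cls f a| - (#|cls f a| %/ m) * m) <= m by apply: geq_minl.
  rewrite -card_chunk //; apply: leq_trans; apply: subset_leq_card.
  apply/subsetP => v; rewrite !inE => /andP[/eqP fv]; rewrite fv eqxx card_clsg.
  have vf : v \in cls f a by rewrite inE fv.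
  rewrite fv inordK ?chunk_lt // => h.
  have : index v (enum (cls f a)) < #|cls f a| by rewrite cardE index_mem mem_enum.
  move: h; rewrite /chunk; move: (index _ _) => i h il.
  have [h1 h2] : #|cls f a| < (i %/ m).+1 * m /\ i %/ m <= #|cls f a| %/ m.
    by split; [lia|rewrite leq_div2r // ltnW].
  by rewrite eqn_leq h2 -ltnS ltn_divLR.
have hleft : Q * #|[set v | g v \notin L]| <= #|V|.
  have : #|[set v | g v \notin L]| <= #|T| * m.
    rewrite -sum1_card (partition_big f predT) //= -sum_nat_const.
    apply: leq_sum => a _; rewrite sum1_card; apply: leq_trans (left a).
    by apply: subset_leq_card; apply/subsetP => v;
      rewrite [in X in _ -> X]inE => /andP[]; rewrite inE => -> ->.
  have := leq_trunc_div #|V| (Q * #|T|); rewrite -/m; nia.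
have cL : #|V| <= #|L| * m + #|[set v | g v \notin L]| by apply: card_cls_cover.
set bad := [set p : _ * _ | [&& p.1 \in L, p.2 \in L, ~~ pure e g p.1 p.2
        & ~~ joined e (m %/ D) (cls g p.1) (cls g p.2)]].
case: (leqP (Q ^ 2 * #|bad|) (#|L| ^ 2)) => hbad; [by left; exists g, L|right].
pose hole a b (XY : {set V} * {set V}) :=
  [&& XY.1 \subset cls g a, XY.2 \subset cls g b, m %/ D <= #|XY.1|,
      m %/ D <= #|XY.2| & [forall x in XY.1, forall y in XY.2, ~~ e x y]].
(* The default occurs only for pairs without a hole, hence never for bad ones. *)
pose XY a b := odflt (set0, set0) [pick p | hole a b p].
have holeP a b : (a, b) \in bad -> hole a b (XY a b).
  rewrite inE /= => /and4P[_ _ _ nj]; rewrite /XY; case: pickP => //= no.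
  case/joinedP: nj => X Y Xa Yb sX sY; move: (no (X, Y)).
  rewrite /hole Xa Yb sX sY /= => /negbT; rewrite negb_forall => /existsP[x].
  rewrite negb_imply negb_forall => /andP[xX /existsP[y]].
  by rewrite negb_imply negbK => /andP[yY exy]; exists x, y.
pose h := refine_by g (fun a b => (XY a b).1) (fun a b => (XY a b).2).
exists _, h; split.
  by rewrite !card_prod !card_ffun !card_prod !card_bool !card_ord.
have : pure_mass e g + #|bad| * ((m %/ D) * (m %/ D)) <= pure_mass e h.
  apply: pure_mass_refine_by => a b abB.
  have /and5P[Xa Yb sX sY /forall_inP no] := holeP a b abB.
  move: abB; rewrite inE => /and4P[_ _ np _]; do !split => //.
  by move=> x y /no/forall_inP; apply.
have : pure_mass e f <= pure_mass e g by apply: pure_mass_refine => x y [].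
(* Write [s] for [m %/ D]. At most half of [V] is left over, so [#|V| <= 4 * #|L| * D * s]; squaring
   and using [#|L| ^ 2 < Q ^ 2 * #|bad|] gives the factor [16 * Q ^ 2 * D ^ 2]. *)
have mDs : m <= 2 * D * (m %/ D).
  have := ltn_ceil m D0; have : 0 < m %/ D by rewrite divn_gt0.
  nia.
have nL : #|V| <= 2 * (#|L| * m) by nia.
move: (m %/ D) mDs => s mDs hfg hgh.
have nLs : #|V| <= 4 * #|L| * D * s by nia.
have : #|V| ^ 2 <= (4 * #|L| * D * s) ^ 2 by rewrite leq_exp2r.
have : 16 * (#|L| ^ 2) * (D ^ 2 * s ^ 2) <= 16 * (Q ^ 2 * #|bad|) * (D ^ 2 * s ^ 2).
  by rewrite leq_mul // leq_mul // ltnW.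
have : 16 * Q ^ 2 * D ^ 2 * (pure_mass e f + #|bad| * (s * s))
   <= 16 * Q ^ 2 * D ^ 2 * pure_mass e h by rewrite leq_mul //; lia.
by move: (pure_mass e f) (pure_mass e h) => pf ph; rewrite !expnS !expn0; nia.
Qed.

Lemma chunk_labels_ge (Q K : nat) : K <= chunk_labels Q K.
Proof. by rewrite /chunk_labels mulnS leq_addr. Qed.

Lemma next_labels_ge (Q K : nat) : K <= next_labels Q K.
Proof.
apply: leq_trans (chunk_labels_ge Q K) _; rewrite /next_labels -mulnA.
by rewrite leq_pmulr // muln_gt0 !expn_gt0.
Qed.

Lemma leq_iter_next (Q i j : nat) : i <= j ->
  iter i (next_labels Q) 1 <= iter j (next_labels Q) 1.
Proof.
elim: j => [|j IH]; first by rewrite leqn0 => /eqP->.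
rewrite leq_eqVlt => /predU1P[-> //|]; rewrite ltnS => /IH h.
by apply: leq_trans h _; apply: next_labels_ge.
Qed.

Definition has_clustering (V : finType) (e : rel V) (Q D K : nat) : Prop :=
  exists (T : finType) (g : V -> T) (L : {set T}) (m : nat),
    [/\ #|T| <= K, #|V| <= K * m, D <= m, Q * m <= #|V|
      & clustering e Q m (m %/ D) g L].

(* The mass of pure pairs starts at 0 and never exceeds #|V|^2, so one of the
   first 16 Q^2 D^2 + 1 refinements must fail to increase it. *)
Lemma clustering_exists (Q D : nat) : 1 < Q -> 0 < D ->
  exists2 K, 0 < K & forall (V : finType) (e : rel V), K <= #|V| ->
    has_clustering e Q D K.
Proof.
move=> Q1 D0; pose S := 16 * Q ^ 2 * D ^ 2.
pose N i := iter i (next_labels Q) 1.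
(* [K] bounds the number of chunk labels in every round and is at least [2 * Q * D * N i], so
   [K <= #|V|] makes the chunk size at least [D]. *)
pose K := 2 * Q * D * chunk_labels Q (N S).
have N_gt0 i : 0 < N i by apply: (@leq_iter_next Q 0).
have K_ge i : i <= S -> 2 * Q * D * N i <= K.
  move=> iS; rewrite leq_mul2l; apply/orP; right.
  exact: leq_trans (leq_iter_next Q iS) (chunk_labels_ge _ _).
exists K.
  have := K_ge 0 (leq0n _); apply: leq_trans.
  by rewrite !muln_gt0 (ltnW Q1) D0.
move=> V e KV.
have step i : i <= S.+1 -> has_clustering e Q D K \/ (exists (U : finType) (h : V -> U),
    #|U| = N i /\ i * #|V| ^ 2 <= S * pure_mass e h).
  elim: i => [|i IH] iS.
    by right; exists unit, (fun=> tt); rewrite card_unit.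
  have [|[U [h [cU hU]]]] := IH (ltnW iS); first by left.
  have U0 : 0 < #|U| by rewrite cU.
  have Ki := K_ge i iS; rewrite -cU in Ki.
  have VU : Q * #|U| * D <= #|V| by apply: leq_trans KV; nia.
  have QU0 : 0 < Q * #|U| by rewrite muln_gt0 U0 (ltnW Q1).
  have [[g [L hL]]|[W [h' [cW hh]]]] := clustering_step e h Q1 D0 U0 VU.
    left; exists _, g, L, (#|V| %/ (Q * #|U|)).
    have Dm : D <= #|V| %/ (Q * #|U|) by rewrite leq_divRL // mulnC.
    split=> //.
    - rewrite card_prod card_ord; apply: (@leq_trans (chunk_labels Q (N S))).
        rewrite /chunk_labels -/(N i) cU leq_mul ?ltnS ?leq_mul //;
        exact: leq_iter_next.
      by rewrite /K leq_pmull // !muln_gt0 (ltnW Q1) D0.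
    - have := ltn_ceil #|V| QU0; move: (_ %/ _) Dm => m Dm; nia.
    - have := leq_trunc_div #|V| (Q * #|U|); move: (_ %/ _) => m; nia.
  right; exists W, h'; split; first by rewrite cW cU.
  by rewrite mulSn; rewrite -/S in hh; lia.
have [//|[U [h [_]]]] := step S.+1 (leqnn _).
have : pure_mass e h <= #|V| ^ 2.
  by apply: leq_trans (max_card _) _; rewrite card_prod mulnn.
have V0 : 0 < #|V| ^ 2.
  rewrite expn_gt0; apply/orP; left; apply: leq_trans KV.
  have := K_ge 0 (leq0n _); apply: leq_trans.
  by rewrite !muln_gt0 (ltnW Q1) D0.
nia.
Qed.

(** * Connected matchings in almost complete 2-colored graphs *)

(** Edges are ordered pairs; listing all endpoints turns disjointness of the edges into [uniq]. *)
Definition covered (T : Type) (s : seq (T * T)) : seq T := unzip1 s ++ unzip2 s.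

Arguments covered : simpl never.

Definition matching (T : finType) (c : rel T) (Z : {set T}) (s : seq (T * T))
    : bool :=
  uniq (covered s) && all (fun p => [&& p.1 \in Z, p.2 \in Z & c p.1 p.2]) s.

Lemma perm_covered_cons (T : eqType) (p : T * T) (s : seq (T * T)) :
  perm_eq (covered (p :: s)) (p.1 :: p.2 :: covered s).
Proof. by rewrite /covered /= perm_cons perm_catC /= perm_cons perm_catC. Qed.

Lemma perm_covered (T : eqType) (s t : seq (T * T)) :
  perm_eq s t -> perm_eq (covered s) (covered t).
Proof. by move=> st; apply: perm_cat; apply: perm_map. Qed.

Lemma matching_cons (T : finType) (c : rel T) (Z : {set T}) p s :
  matching c Z (p :: s) = [&& p.1 != p.2, p.1 \notin covered s,
    p.2 \notin covered s, p.1 \in Z, p.2 \in Z, c p.1 p.2 & matching c Z s].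
Proof.
rewrite /matching (perm_uniq (perm_covered_cons p s)) /= inE negb_or.
by case: (_ != _) (_ \notin _) (_ \notin _) (uniq _) => [] [] [] [];
  rewrite /= ?andbF -?andbA.
Qed.

Lemma matching_perm (T : finType) (c : rel T) (Z : {set T}) s t :
  perm_eq s t -> matching c Z s = matching c Z t.
Proof.
by move=> st; rewrite /matching (perm_uniq (perm_covered st)) (perm_all _ st).
Qed.

Lemma matching_covered (T : finType) (c : rel T) (Z : {set T}) s x :
  matching c Z s -> x \in covered s -> x \in Z.
Proof.
move=> /andP[_ /allP h]; rewrite mem_cat => /orP[] /mapP[p /h/and3P[h1 h2 _]] ->//.
Qed.

Lemma size_covered (T : Type) (s : seq (T * T)) :
  size (covered s) = 2 * size s.
Proof. by rewrite size_cat !size_map mul2n addnn. Qed.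

Lemma max_matching (T : finType) (c : rel T) (Z : {set T}) :
  exists2 s, matching c Z s & forall t, matching c Z t -> size t <= size s.
Proof.
pose P n := [exists t : n.-tuple (T * T), matching c Z t].
have bound n : P n -> n <= #|T|.
  case/existsP => t /andP[]; rewrite cat_uniq => /andP[/card_uniqP h _] _.
  have := max_card (mem (unzip1 t)); rewrite h size_map size_tuple.
  by apply: leq_trans.
have P0 : exists n, P n by exists 0; apply/existsP; exists [tuple].
case: (ex_maxnP P0 bound) => n /existsP[s hs] hmax.
exists s => // t ht; rewrite size_tuple; apply: hmax.
by apply/existsP; exists (in_tuple t).
Qed.

(** Each vertex of [Y] misses at most [d] vertices of [U], and fewer than [size Y] vertices of [U]
    are taken when its turn comes. *)
Lemma greedy_star (T : finType) (c : rel T) (d : nat) (Y : seq T) (U : {set T}) :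
  (forall y, y \in Y -> #|[set u in U | ~~ c y u]| <= d) ->
  size Y + d <= #|U| ->
  exists us, [/\ size us = size Y, uniq us, {subset us <= U}
    & all (fun p => c p.1 p.2) (zip Y us)].
Proof.
elim: Y U => [|y Y IH] U hY hU; first by exists [::].
have [u uU cyu] : exists2 u, u \in U & c y u.
  apply/exists_inP; rewrite -[X in is_true X]negbK negb_exists; apply/negP => /forallP no.
  have := hY y (mem_head _ _); rewrite (_ : [set u in U | ~~ c y u] = U).
    by move=> h; move: hU; rewrite /= addSn => /leq_trans/(_ h); lia.
  by apply/setP => u; rewrite inE; have := no u; case: (u \in U).
have [||us [su uu usU cu]] := IH (U :\ u).
- move=> y' y'Y; apply: leq_trans (hY y' _); last by rewrite inE y'Y orbT.
  by apply: subset_leq_card; apply/subsetP => z; rewrite !inE => /andP[/andP[_ ->]].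
- by move: hU; rewrite (cardsD1 u U) uU /=; lia.
exists (u :: us); split=> /=.
- by rewrite su.
- by rewrite uu andbT; apply/negP => /usU; rewrite !inE eqxx.
- by move=> z; rewrite inE => /predU1P[->//|/usU]; rewrite !inE => /andP[].
- by rewrite cyu.
Qed.

(** As long as more than [d] vertices remain, any of them has a partner among the others; the
    conjunct [x != u] counts the vertex itself among the missed ones. *)
Lemma greedy_inside (T : finType) (c : rel T) (d : nat) (U : {set T}) :
  (forall x, x \in U -> #|[set u in U | ~~ (c x u && (x != u))]| <= d) ->
  exists2 s, matching c U s & #|U| <= 2 * size s + d.
Proof.
have [n] := ubnP #|U|; elim: n U => // n IH U hn hU.
case: (leqP #|U| d) => [Ud|dU]; first by exists [::] => //; rewrite muln0.
have [x xU] : exists x, x \in U by apply/card_gt0P; lia.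
have [u uU /andP[cxu xu]] : exists2 u, u \in U & c x u && (x != u).
  apply/exists_inP; rewrite -[X in is_true X]negbK negb_exists; apply/negP => /forallP no.
  have := hU x xU; rewrite (_ : [set u in U | _] = U); first by lia.
  by apply/setP => u; rewrite inE; have := no u; case: (u \in U).
have cU : #|U| = (#|U :\ x :\ u|).+2.
  by rewrite (cardsD1 x U) xU (cardsD1 u (U :\ x)) !inE uU eq_sym xu.
have sub : U :\ x :\ u \subset U by apply: subset_trans (subD1set _ _) (subD1set _ _).
have [||s ms hs] := IH (U :\ x :\ u).
- by lia.
- move=> y; rewrite !inE => /and3P[_ _ yU]; apply: leq_trans (hU y yU).
  apply: subset_leq_card; apply/subsetP => z; rewrite !inE.
  by move=> /andP[/and3P[_ _ ->]].
exists ((x, u) :: s); last by rewrite cU /=; lia.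
rewrite matching_cons /= xu xU uU cxu /=.
have cov z : z \in covered s -> z \in U :\ x :\ u by apply: matching_covered ms.
apply/and3P; split.
- by apply/negP => /cov; rewrite !inE eqxx andbF.
- by apply/negP => /cov; rewrite !inE eqxx.
case/andP: ms => us /allP as_; rewrite /matching us; apply/allP => p /as_.
by case/and3P => /(subsetP sub)-> /(subsetP sub)-> ->.
Qed.

Definition within (T : finType) (L : {set T}) (c : rel T) : rel T :=
  fun x y => [&& x \in L, y \in L & c x y].

(** It suffices to connect the first endpoints, since the endpoints of each pair are adjacent within
    [L]. *)
Definition connected_matching (T : finType) (L : {set T}) (c : rel T)
    (s : seq (T * T)) : Prop :=
  matching c L s /\
  forall p q, p \in s -> q \in s -> connect (within L c) p.1 q.1.

Lemma common_neighbour (T : finType) (c : rel T) (U : {set T}) (d : nat) x y :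
  #|[set u in U | ~~ c x u]| <= d -> #|[set u in U | ~~ c y u]| <= d ->
  2 * d < #|U| -> exists u, [/\ u \in U, c x u & c y u].
Proof.
move=> hx hy big.
suff /card_gt0P[u] : 0 < #|[set u in U | c x u && c y u]|.
  by rewrite inE => /and3P[]; exists u.
have : #|U| <= #|[set u in U | c x u && c y u]| +
    (#|[set u in U | ~~ c x u]| + #|[set u in U | ~~ c y u]|).
  apply: leq_trans (leq_add (leqnn _) (leq_card_setU _ _)).
  apply: leq_trans (leq_card_setU _ _); apply: subset_leq_card.
  apply/subsetP => u uU; rewrite !inE uU.
  by case: (c x u) (c y u) => [] [].
by lia.
Qed.

(* With s a maximum c1-matching of Z and U the unmatched vertices, c1 is empty
   on U, and each edge of s has an endpoint with at most one c1-neighbour in U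
   (otherwise s could be augmented).  Hence c2 is almost complete on U and
   between U and these endpoints, which yields a c2-matching covering them. *)
Lemma unmatched_other_color (T : finType) (c1 c2 : rel T) (L Z : {set T}) (d : nat)
    (s : seq (T * T)) :
  symmetric c2 -> Z \subset L ->
  (forall x, x \in L ->
     #|[set y in L | [&& y != x, ~~ c1 x y & ~~ c2 x y]]| <= d) ->
  matching c1 Z s -> (forall t, matching c1 Z t -> size t <= size s) ->
  2 * d + 6 + 3 * size s <= #|Z| -> 3 * d + 6 + 2 * size s <= #|Z| ->
  exists2 t, connected_matching L c2 t & #|Z| <= 2 * size t + size s + d + 2.
Proof.
move=> sc2 ZL hbad ms smax big1 big2.
set U := [set x in Z | x \notin covered s].
have us : uniq (covered s) by case/andP: ms.
have covZ x : x \in covered s -> x \in Z by apply: matching_covered ms.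
have cU : #|U| + 2 * size s = #|Z|.
  rewrite -size_covered -(card_uniqP us) -(cardsID [set x in covered s] Z) addnC.
  congr (_ + _); apply: eq_card => x; rewrite !inE; last by rewrite andbC.
  by case: (boolP (x \in covered s)) => [/covZ->|]; rewrite ?andbF.
have UZ x : x \in U -> x \in Z by rewrite inE => /andP[].
have Ucov x : x \in U -> x \notin covered s by rewrite inE => /andP[].
have U_no_c1 x y : x \in U -> y \in U -> x != y -> ~~ c1 x y.
  move=> xU yU xy; apply/negP => cxy; have := smax ((x, y) :: s).
  rewrite matching_cons /= xy (Ucov x) // (Ucov y) // (UZ x) // (UZ y) // cxy ms.
  by move=> /(_ isT); rewrite ltnn.
(* The endpoint with at most one [c1]-neighbour in [U]; if the first endpoint has two, maximality of
   [s] forces this for the second. *)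
pose y p := if #|[set u in U | c1 p.1 u]| <= 1 then p.1 else p.2 : T.
have y_or p : (y p == p.1) || (y p == p.2).
  by rewrite /y; case: ifP; rewrite eqxx ?orbT.
have y_c1 p : p \in s -> #|[set u in U | c1 (y p) u]| <= 1.
  move=> ps; rewrite /y; case: ifPn => //; rewrite -!ltnNge => h1.
  rewrite leqNgt; apply/negP => h2.
  have /card_gt0P[u] : 0 < #|[set u in U | c1 p.1 u]| by apply: ltnW.
  rewrite inE => /andP[uU c1u].
  have /card_gt0P[v] : 0 < #|[set u in U | c1 p.2 u] :\ u|.
    by move: h2; rewrite (cardsD1 u); case: (u \in _) => /=; lia.
  rewrite !inE => /and3P[vu /andP[vZ vcov] c1v].
  (* Replacing [p] by two edges to distinct unmatched vertices would enlarge [s]. *)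
  have := smax ((p.1, u) :: (p.2, v) :: rem p s).
  have psr : perm_eq s (p :: rem p s) by apply: perm_to_rem.
  rewrite (perm_size psr) /=.
  have cov z : (z \in covered s) = [|| z == p.1, z == p.2 | z \in covered (rem p s)].
    by rewrite (perm_mem (perm_covered psr)) (perm_mem (perm_covered_cons _ _)) !inE.
  have := ms; rewrite (matching_perm _ _ psr) !matching_cons.
  rewrite !(perm_mem (perm_covered_cons _ _)) /= !in_cons.
  case/and5P=> p12 n1 n2 z1 /and3P[z2 _ ->]; rewrite andbT z1 z2 c1u c1v.
  move: (Ucov u uU) vcov; rewrite !cov !negb_or => /and3P[u1 u2 u3] /and3P[v1 v2 v3].
  rewrite p12 n1 n2 u3 v3 vZ (UZ u) //.
  by rewrite (eq_sym p.1 u) u1 u2 (eq_sym p.1 v) v1 (eq_sym p.2 v) v2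
    (eq_sym u v) vu /= => /(_ isT); rewrite ltnn.
pose Y := map y s.
have Ycov z : z \in Y -> z \in covered s.
  case/mapP => p ps ->; rewrite mem_cat.
  by case/orP: (y_or p) => /eqP->; rewrite map_f ?orbT.
have uY : uniq Y.
  rewrite /Y; elim: (s) us => [//|p s' IH].
  rewrite (perm_uniq (perm_covered_cons p s')) /= inE negb_or.
  case/and3P=> /andP[_ p1] p2 us'; rewrite IH // andbT.
  apply/mapP => -[q qs' E].
  have : y q \in covered s'.
    by rewrite mem_cat; case/orP: (y_or q) => /eqP->; rewrite map_f ?orbT.
  by rewrite -E; case/orP: (y_or p) => /eqP->; apply/negP.
have badU x : x \in L -> #|[set u in U | [&& u != x, ~~ c1 x u & ~~ c2 x u]]| <= d.
  move=> xL; apply: leq_trans (hbad x xL); apply: subset_leq_card.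
  by apply/subsetP => z; rewrite inE => /andP[/UZ/(subsetP ZL) zL h]; rewrite inE zL.
have nb_Y z : z \in Y -> #|[set u in U | ~~ c2 z u]| <= d + 2.
  move=> zY; have zL : z \in L by apply: (subsetP ZL); apply: covZ; apply: Ycov.
  have c1z : #|[set u in U | c1 z u]| <= 1 by case/mapP: zY => p /y_c1 h ->.
  apply: leq_trans (leq_trans (leq_add (badU z zL) c1z) _); last by lia.
  rewrite -cardsUI; apply: leq_trans (leq_addr _ _); apply: subset_leq_card.
  apply/subsetP => u; rewrite !inE => /andP[/andP[uZ ucov] ->].
  rewrite uZ ucov /=; have -> : u != z by apply: contraNneq ucov => ->; apply: Ycov.
  by case: (c1 z u).
have nb_U z : z \in U -> #|[set u in U | ~~ (c2 z u && (z != u))]| <= d + 2.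
  move=> zU; have zL : z \in L by apply: (subsetP ZL); apply: UZ.
  have z1 : #|[set z]| <= 1 by rewrite cards1.
  apply: leq_trans (leq_trans _ (leq_add (badU z zL) z1)) _; last by lia.
  rewrite -cardsUI; apply: leq_trans (leq_addr _ _); apply: subset_leq_card.
  apply/subsetP => u; rewrite [in X in X -> _]inE => /andP[uU].
  rewrite !in_setU !in_set1 inE uU /= negb_and negbK (eq_sym z u).
  case: (boolP (u == z)) => [|uz]; first by rewrite orbT.
  by rewrite (U_no_c1 z u) // 1?eq_sym // !orbF.
(* The chosen endpoints [Y] are matched into [U] first, then the rest [U'] of [U] within itself, for
   a total of about [(#|Z| - size s) / 2] edges. *)
have [|ust [sus uus usU cus]] := greedy_star nb_Y (U := U).
  by rewrite size_map; lia.
pose U' := U :\: [set x in ust].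
have cU' : #|U'| + size s = #|U|.
  rewrite -(size_map y s) -/Y -sus -(card_uniqP uus) addnC -(cardsID [set x in ust] U).
  congr (_ + _); apply: eq_card => x; rewrite !inE.
  by case: (boolP (x \in ust)) => [/usU|_]; rewrite ?andbF //= inE => ->.
have [|t mt ct] := @greedy_inside _ c2 (d + 2) U'.
  move=> x; rewrite inE => /andP[_ /nb_U]; apply: leq_trans; apply: subset_leq_card.
  by apply/subsetP => z; rewrite !inE => /andP[/andP[_ ->]].
have sYu : size Y <= size ust by rewrite sus.
have suY : size ust <= size Y by rewrite sus.
have inL x : x \in U -> x \in L by move=> /UZ/(subsetP ZL).
exists (zip Y ust ++ t); last by rewrite size_cat size_zip sus minnn /Y size_map; lia.
have cov_perm : perm_eq (covered (zip Y ust ++ t)) (Y ++ ust ++ covered t).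
  rewrite /covered /unzip1 /unzip2 !map_cat -/(unzip1 _) -/(unzip2 _).
  rewrite -!/(unzip1 _) -!/(unzip2 _) unzip1_zip // unzip2_zip // -!catA perm_cat2l.
  by rewrite perm_catCA.
have tU' x : x \in covered t -> x \in U' by apply: matching_covered mt.
split.
  apply/andP; split.
    rewrite (perm_uniq cov_perm) 2!cat_uniq uY uus; case/andP: mt => -> _.
    rewrite /= andbT; apply/andP; split.
      apply/hasPn => x; rewrite mem_cat => /orP[/usU xU|/tU']; last first.
        by rewrite 3!inE => /and3P[_ _ h]; apply: contra h; apply: Ycov.
      by apply: contra (Ucov x xU); apply: Ycov.
    by apply/hasPn => x /tU'; rewrite !inE => /andP[].
  rewrite all_cat; apply/andP; split.
    apply/allP => -[a b] abz; rewrite /= (allP cus _ abz) andbT.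
    have aY : a \in Y by rewrite -(unzip1_zip sYu); apply: (map_f fst abz).
    have bu : b \in ust by rewrite -(unzip2_zip suY); apply: (map_f snd abz).
    by rewrite (subsetP ZL) ?covZ ?Ycov // inL // usU.
  case/andP: mt => _ /allP h; apply/allP => p /h/and3P[h1 h2 ->].
  by move: h1 h2; rewrite !inE => /andP[_ /andP[h1 _]] /andP[_ /andP[h2 _]]; rewrite !(subsetP ZL).
(* Vertices that miss few vertices of [U] have a common [c2]-neighbour there, which puts all the
   edges into one component. *)
have link x z : x \in L -> z \in L -> #|[set u in U | ~~ c2 x u]| <= d + 2 ->
    #|[set u in U | ~~ c2 z u]| <= d + 2 -> connect (within L c2) x z.
  move=> xL zL hx hz.
  have [|u [/inL uL cxu czu]] := common_neighbour hx hz; first by lia.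
  apply: (@connect_trans _ _ u); apply: connect1; first by rewrite /within xL uL.
  by rewrite /within uL zL sc2.
have M1 p : p \in zip Y ust ++ t ->
    p.1 \in L /\ #|[set u in U | ~~ c2 p.1 u]| <= d + 2.
  rewrite mem_cat => /orP[pz|pt].
    have pY : p.1 \in Y by rewrite -(unzip1_zip sYu); apply: (map_f fst pz).
    by split; [apply: (subsetP ZL); apply: covZ; apply: Ycov|apply: nb_Y].
  have pU : p.1 \in U.
    have : p.1 \in covered t by rewrite mem_cat (map_f fst pt).
    by move/tU'; rewrite inE => /andP[].
  split; first exact: inL.
  apply: leq_trans (nb_U _ pU); apply: subset_leq_card; apply/subsetP => u.
  by rewrite !inE negb_and => /andP[-> ->].
by move=> p q /M1[p1 p2] /M1[q1 q2]; apply: link.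
Qed.

(** If a maximum [c1]-matching [s] of [Z] has fewer than about [#|L| / 3] edges, the matching in the
    other color has about [(#|Z| - size s) / 2], hence at least about [#|L| / 3]. This balance is
    the origin of the constant 2/3. *)
Lemma connected_matching_of_component (T : finType) (c1 c2 : rel T)
    (L Z : {set T}) (d : nat) :
  symmetric c2 -> Z \subset L ->
  (forall x, x \in L ->
     #|[set y in L | [&& y != x, ~~ c1 x y & ~~ c2 x y]]| <= d) ->
  (forall x y, x \in Z -> y \in Z -> connect (within L c1) x y) ->
  #|L| <= #|Z| + 2 * d ->
  exists2 t, connected_matching L c1 t \/ connected_matching L c2 t
    & #|L| <= 3 * size t + 9 * d + 10.
Proof.
move=> sc2 ZL hbad Zconn bigZ; have [s ms smax] := max_matching c1 Z.
case: (leqP #|L| (3 * size s + 9 * d + 10)) => hs.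
  exists s => //; left; split.
    case/andP: ms => us /allP as_; rewrite /matching us; apply/allP => p /as_.
    by case/and3P => /(subsetP ZL)-> /(subsetP ZL)-> ->.
  move=> p q ps qs; apply: Zconn; apply: (matching_covered ms);
  by rewrite mem_cat map_f.
have [||t ht ct] := unmatched_other_color sc2 ZL hbad ms smax; [lia|lia|].
by exists t; [right|lia].
Qed.

(** If some [c1]-component has more than [2 * d] vertices, either it is almost all of [L], or more
    than [2 * d] vertices lie outside and the almost complete [c2]-graph between the two sides
    connects [L]. If all [c1]-components are small, [c2] itself is almost complete. *)
Lemma connected_matching_exists (T : finType) (c1 c2 : rel T) (L : {set T})
    (d : nat) :
  symmetric c1 -> symmetric c2 ->
  (forall x, x \in L ->
     #|[set y in L | [&& y != x, ~~ c1 x y & ~~ c2 x y]]| <= d) ->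
  exists2 t, connected_matching L c1 t \/ connected_matching L c2 t
    & #|L| <= 3 * size t + 9 * d + 10.
Proof.
move=> sc1 sc2 hbad.
case: (leqP #|L| (9 * d + 10)) => bigL; first by exists [::]; [left|].
have hbad' x : x \in L -> #|[set y in L | [&& y != x, ~~ c2 x y & ~~ c1 x y]]| <= d.
  move=> xL; apply: leq_trans (hbad x xL); apply: subset_leq_card.
  by apply/subsetP => y; rewrite !inE => /and4P[-> -> -> ->].
have flip : (exists2 t, connected_matching L c2 t \/ connected_matching L c1 t
    & #|L| <= 3 * size t + 9 * d + 10) -> exists2 t, connected_matching L c1 t \/
    connected_matching L c2 t & #|L| <= 3 * size t + 9 * d + 10.
  by case=> t [] h ?; exists t; [right| |left|].
have cs2 : connect_sym (within L c2).
  apply: sym_connect_sym => x y; rewrite /within sc2.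
  by case: (x \in L) (y \in L) => [] [].
have step2 x y : x \in L -> y \in L -> c2 x y -> connect (within L c2) x y.
  by move=> xL yL cxy; apply: connect1; rewrite /within xL yL.
have two x y w : x \in L -> y \in L -> w \in L -> c2 x w -> c2 y w ->
    connect (within L c2) x y.
  move=> xL yL wL cx cy; apply: (@connect_trans _ _ w); first exact: step2.
  by apply: step2; rewrite // sc2.
pose comp x := [set y in L | connect (within L c1) x y].
case: (boolP [exists x in L, 2 * d < #|comp x|]) => [/exists_inP[x xL bigC]|small].
  have CL : comp x \subset L by apply/subsetP => y; rewrite inE => /andP[].
  have CconnP y z : y \in comp x -> z \in comp x -> connect (within L c1) y z.
    rewrite !inE => /andP[yL cy] /andP[zL]; apply: connect_trans.
    rewrite sym_connect_sym // => a b; rewrite /within sc1.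
    by case: (a \in L) (b \in L) => [] [].
  case: (leqP #|L| (#|comp x| + 2 * d)) => hC.
    exact: connected_matching_of_component CL hbad CconnP hC.
  apply: flip; apply: (@connected_matching_of_component _ c2 c1 L L) => //; last by lia.
  have bigW : 2 * d < #|L :\: comp x| by rewrite cardsD (setIidPr CL); lia.
  have no_c1 y w : y \in comp x -> w \in L :\: comp x -> ~~ c1 y w.
    rewrite !inE => /andP[yL cy] /andP[+ wL]; rewrite wL /=.
    apply: contra => cyw; apply: connect_trans cy (connect1 _).
    by rewrite /within yL wL.
  have nbC y : y \in comp x -> #|[set w in L :\: comp x | ~~ c2 y w]| <= d.
    move=> yC; apply: leq_trans (hbad y (subsetP CL y yC)); apply: subset_leq_card.
    apply/subsetP => w; rewrite 2!inE => /andP[wW ->]; rewrite (no_c1 y w) //.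
    move: wW; rewrite inE => /andP[wC ->]; rewrite /= andbT.
    by apply: contraNneq wC => ->.
  have nbW w : w \in L :\: comp x -> #|[set y in comp x | ~~ c2 w y]| <= d.
    move=> wW; have wL : w \in L by move: wW; rewrite inE => /andP[].
    apply: leq_trans (hbad w wL); apply: subset_leq_card.
    apply/subsetP => y; rewrite 2!inE => /andP[yC ->]; rewrite sc1 (no_c1 y w) //.
    rewrite (subsetP CL) //= andbT.
    by apply: contraTneq yC => ->; move: wW; rewrite inE => /andP[].
  have CC y z : y \in comp x -> z \in comp x -> connect (within L c2) y z.
    move=> yC zC; have [|w [wW cy cz]] := common_neighbour (nbC y yC) (nbC z zC).
      by [].
    apply: (two _ _ w) => //; try exact: (subsetP CL).
    by move: wW; rewrite inE => /andP[].
  have toC w : w \in L -> exists2 y, y \in comp x & connect (within L c2) w y.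
    move=> wL; case: (boolP (w \in comp x)) => wC; first by exists w.
    have wW : w \in L :\: comp x by rewrite inE wC.
    have [|y [yC cy _]] := common_neighbour (nbW w wW) (nbW w wW); first by lia.
    by exists y => //; apply: step2 => //; apply: (subsetP CL).
  move=> y z /toC[y' yC cy] /toC[z' zC cz].
  apply: connect_trans cy (connect_trans (CC _ _ yC zC) _).
  by rewrite cs2.
apply: flip; apply: (@connected_matching_of_component _ c2 c1 L L) => //; last by lia.
have nb x : x \in L -> #|[set w in L | ~~ c2 x w]| <= 3 * d.
  move=> xL; have cx : #|comp x| <= 2 * d.
    by rewrite leqNgt; apply: contra small => h; apply/exists_inP; exists x.
  apply: leq_trans (leq_trans _ (leq_add (hbad x xL) cx)) _; last by lia.
  rewrite -cardsUI; apply: leq_trans (leq_addr _ _); apply: subset_leq_card.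
  apply/subsetP => w; rewrite 4!inE => /andP[wL ->]; rewrite wL andbT /=.
  case: eqP => [->|_] /=; first exact: connect0.
  case: (boolP (c1 x w)) => //= cxw.
  by apply: connect1; rewrite /within xL wL.
move=> x y xL yL; have [|w [wL cx cy]] := common_neighbour (nb x xL) (nb y yL).
  by lia.
exact: two cx cy.
Qed.

(** * Cycles through a connected matching *)

Lemma sorted_cat_cons (T : Type) (e : rel T) (p q : seq T) (x : T) :
  sorted e (p ++ x :: q) = sorted e (rcons p x) && path e x q.
Proof.
by case: p => [|y p] //=; rewrite -cat_rcons cat_path last_rcons.
Qed.

(** [p] is the current search path, [S] holds the unvisited and [D] the finished vertices. *)
Definition dfs_split (V : finType) (e : rel V) (X : {set V}) (p : seq V)
    (S D : {set V}) : Prop :=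
  (forall x, (x \in X) = [|| x \in p, x \in S | x \in D]) /\
  [/\ forall x, x \in p -> x \notin S, forall x, x \in p -> x \notin D,
      forall x, x \in S -> x \notin D
    & forall x y, x \in D -> y \in S -> ~~ e x y].

(* Depth-first search, stopped when as many vertices are unvisited as are
   finished. *)
Lemma dfs_path (V : finType) (e : rel V) (X : {set V}) :
  exists (p : seq V) (S D : {set V}),
    [/\ sorted e p, uniq p, #|S| = #|D| & dfs_split e X p S D].
Proof.
(* The path is kept reversed, with its end as head. Every move takes a vertex from [S] or puts one
   into [D], so the excess [n] drops by one. *)
suff main n (p : seq V) (S D : {set V}) : sorted e (rev p) -> uniq p ->
    #|S| = #|D| + n -> dfs_split e X p S D ->
    exists (p : seq V) (S D : {set V}),
      [/\ sorted e p, uniq p, #|S| = #|D| & dfs_split e X p S D].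
  apply: (main #|X| [::] X set0) => //; first by rewrite cards0.
  split; first by move=> x; rewrite !inE orbF.
  by split=> // x y; rewrite !inE.
elim: n p S D => [|n IH] p S D sp up cSD [hX [pS pD SD noe]].
  exists (rev p), S, D; rewrite rev_uniq; split=> //; first by rewrite cSD addn0.
  split; first by move=> x; rewrite mem_rev.
  by split=> // x; rewrite mem_rev; [apply: pS|apply: pD].
have move_S y : y \in S -> sorted e (rev (y :: p)) ->
    exists (p : seq V) (S D : {set V}),
      [/\ sorted e p, uniq p, #|S| = #|D| & dfs_split e X p S D].
  move=> yS sy; apply: (IH (y :: p) (S :\ y) D) => //.
  - by rewrite /= up andbT; apply: contraL yS; apply: pS.
  - by move: cSD; rewrite (cardsD1 y S) yS; lia.
  split=> [x|].
    rewrite hX !inE; case: eqP => [->|] //=.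
    by rewrite yS orbT.
  split=> x.
  - by rewrite !inE => /predU1P[->|/pS/negbTE->]; rewrite ?eqxx ?andbF.
  - by rewrite inE => /predU1P[->|/pD //]; apply: SD.
  - by rewrite inE => /andP[_ /SD].
  - by move=> z xD; rewrite inE => /andP[_]; apply: noe.
case: p sp up hX pS pD move_S => [|x p] sp up hX pS pD move_S.
  have /card_gt0P[y yS] : 0 < #|S| by lia.
  exact: (move_S y).
case: (boolP [exists y in S, e x y]) => [/exists_inP[y yS exy]|].
  apply: (move_S y) => //; rewrite rev_cons rev_cons -cats1 cat_rcons sorted_cat_cons.
  by rewrite -rev_cons sp /= exy.
rewrite negb_exists => /forallP no.
apply: (IH p S (x |: D)) => //.
- by move: sp; rewrite rev_cons -cats1 => /cat_sorted2[].
- by case/andP: up.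
- by rewrite cardsU1 pD ?mem_head // cSD addnS add1n addSn.
split=> [z|].
  by rewrite hX !inE -!orbA; do 3!bool_congr.
split=> z.
- by move=> zp; apply: pS; rewrite inE zp orbT.
- move=> zp; rewrite !inE negb_or pD ?inE ?zp ?orbT // andbT.
  by case/andP: up => xp _; apply: contraNneq xp => <-.
- move=> zS; rewrite !inE negb_or SD // andbT.
  by apply: contraTneq zS => ->; apply: pS; rewrite mem_head.
- move=> y; rewrite !inE => /predU1P[->|zD] yS; last exact: noe.
  by have := no y; rewrite yS.
Qed.

Definition bipartite (V : Type) (e : rel V) (phi : V -> bool) : Prop :=
  forall x y, e x y -> phi y = ~~ phi x.

Lemma count_phase (V : Type) (e : rel V) (phi : V -> bool) (x : V) (p : seq V) :
  bipartite e phi -> path e x p ->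
  count phi (x :: p) = if phi x then uphalf (size p).+1 else (size p).+1./2.
Proof.
move=> be; elim: p x => [|y p IH] x; first by rewrite /=; case: (phi x).
move=> /andP[/be hy /IH]; rewrite [count _ (x :: _)]/= -[count phi (y :: p)]/(_ + _) => ->.
by rewrite hy; case: (phi x).
Qed.

Lemma count_phase_bounds (V : Type) (e : rel V) (phi : V -> bool) (p : seq V) :
  bipartite e phi -> sorted e p ->
  (size p)./2 <= count phi p <= uphalf (size p).
Proof.
move=> be; case: p => [|x p] // sp; rewrite (count_phase be sp) -[size (x :: p)]/(size p).+1.
by case: (phi x); rewrite !uphalf_half; lia.
Qed.

(** When the search stops, no edge runs between [S] and [D], so joinedness makes one of [S :&: A],
    [D :&: B] small, and one of [D :&: A], [S :&: B]. The path alternates, so [A] and [B] have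
    almost equally many vertices off it; with [#|S| = #|D|] each case bounds their number by about
    [4 * s]. *)
Lemma long_path (V : finType) (e : rel V) (phi : V -> bool) (A B : {set V})
    (M s : nat) :
  symmetric e -> bipartite e phi -> (forall x, x \in A -> phi x) ->
  (forall x, x \in B -> ~~ phi x) -> #|A| = M -> #|B| = M -> joined e s A B ->
  exists p, [/\ sorted e p, uniq p, 2 * M <= size p + 4 * s + 2
    & {subset p <= A :|: B}].
Proof.
move=> se be fA fB cA cB /joinedP jAB.
have [p [S [D [sp up cSD [hX [pS pD SD noe]]]]]] := dfs_path e (A :|: B).
exists p; split=> //; last by move=> x xp; rewrite hX xp.
have phiA x : x \in A :|: B -> (x \in A) = phi x.
  rewrite inE; case: (boolP (x \in A)) => [/fA->//|_] /= /fB /negbTE ->//.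
have phiB x : x \in A :|: B -> (x \in B) = ~~ phi x.
  rewrite inE; case: (boolP (x \in B)) => [/fB->//|_]; rewrite orbF => /fA ->//.
have split_card (C : {set V}) (f : V -> bool) : C \subset A :|: B ->
    (forall x, x \in A :|: B -> (x \in C) = f x) ->
    #|C| = count f p + #|[set x in S | f x]| + #|[set x in D | f x]|.
  move=> CX Cf; rewrite -size_filter -(card_uniqP (filter_uniq _ up)).
  rewrite -(cardsID [set x in p] C) -addnA; congr (_ + _).
    apply: eq_card => x; rewrite !inE mem_filter andbC.
    case: (boolP (x \in p)) => xp; rewrite ?andbF ?andbT //=.
    by apply: Cf; rewrite hX xp.
  rewrite -(cardsID S); congr (_ + _); apply: eq_card => x; rewrite !inE.
    case: (boolP (x \in S)) => xS; rewrite ?andbF //= andbT.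
    rewrite Cf ?hX ?xS ?orbT //; case: (boolP (x \in p)) => // /pS.
    by rewrite xS.
  case: (boolP (x \in D)) => xD /=.
    rewrite Cf ?hX ?xD ?orbT //.
    have -> : x \in p = false by apply/negP => /pD; rewrite xD.
    by have -> : x \in S = false by apply/negP => /SD; rewrite xD.
  case: (boolP (x \in C)) => xC; rewrite ?andbF //.
  by have := subsetP CX x xC; rewrite hX (negbTE xD) orbF; case: (x \in p) (x \in S) => [] [].
have cA' := split_card A phi (subsetUl _ _) phiA.
have cB' := split_card B (fun x => ~~ phi x) (subsetUr _ _) phiB.
have /andP[lo hi] := count_phase_bounds be sp.
have cp := count_predC phi p.
have SX : S \subset A :|: B by apply/subsetP => x xS; rewrite hX xS orbT.
have DX : D \subset A :|: B by apply/subsetP => x xD; rewrite hX xD !orbT.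
have cS : #|S| = #|[set x in S | phi x]| + #|[set x in S | ~~ phi x]|.
  rewrite -(cardsID [set x | phi x] S); congr (_ + _); apply: eq_card => x;
  by rewrite !inE // andbC.
have cD : #|D| = #|[set x in D | phi x]| + #|[set x in D | ~~ phi x]|.
  rewrite -(cardsID [set x | phi x] D); congr (_ + _); apply: eq_card => x;
  by rewrite !inE // andbC.
have no (C C' : {set V}) : C \subset A :|: B -> C' \subset A :|: B ->
    (forall x y, x \in C -> y \in C' -> ~~ e x y) ->
    #|[set x in C | phi x]| < s \/ #|[set x in C' | ~~ phi x]| < s.
  move=> CX CX' h; case: (ltnP #|[set x in C | phi x]| s) => hC; first by left.
  case: (ltnP #|[set x in C' | ~~ phi x]| s) => hC'; first by right.
  have [||x [y []]] := jAB _ _ _ _ hC hC'.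
  - by apply/subsetP => x; rewrite inE => /andP[/(subsetP CX) xX]; rewrite phiA.
  - by apply/subsetP => x; rewrite inE => /andP[/(subsetP CX') xX]; rewrite phiB.
  by rewrite !inE => /andP[xC _] /andP[yC' _]; have /negbTE-> := h x y xC yC'.
have n1 := no D S DX SX noe.
have n2 : #|[set x in S | phi x]| < s \/ #|[set x in D | ~~ phi x]| < s.
  by apply: no => // x y xS yD; rewrite se noe.
have cp' : count phi p + count (fun x => ~~ phi x) p = size p by [].
rewrite uphalf_half in hi.
by case: n1; case: n2; lia.
Qed.

(** * Connecting windows of paths through reservoirs *)

Definition hits (V : finType) (e : rel V) (s : nat) (win : seq V) (W : {set V})
    : Prop :=
  forall Y : {set V}, Y \subset W -> s <= #|Y| ->
    exists v y, [/\ v \in win, y \in Y & e v y].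

Lemma hits_miss (V : finType) (e : rel V) (s : nat) (win : seq V) (W X : {set V}) :
  hits e s win W -> X \subset W ->
  #|X| < s + #|[set y in X | has (e^~ y) win]|.
Proof.
move=> hw XW; rewrite -(cardsID [set y | has (e^~ y) win] X) addnC.
have -> : #|X :&: [set y | has (e^~ y) win]| = #|[set y in X | has (e^~ y) win]|.
  by apply: eq_card => y; rewrite !inE.
rewrite ltn_add2r ltnNge; apply/negP => h.
have [|v [y [vw yX evy]]] := hw _ _ h.
  by apply: subset_trans (subsetDl _ _) XW.
move: yX; rewrite !inE => /andP[/negP[]].
by apply/hasP; exists v.
Qed.

(** From [s] vertices of one set, fewer than [s] vertices of the next set are missed, so at least
    [s] are reached outside [F]; the path is then read off backwards from its end. It is simple
    because the nodes are distinct and the sets [W x] disjoint. *)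
Lemma connector_from (V N : finType) (e : rel V) (rho : rel N)
    (W : N -> {set V}) (s : nat) (F : {set V}) (win : seq V) q y0 (Y : {set V}) :
  symmetric e -> (forall v x y, v \in W x -> v \in W y -> x = y) ->
  (forall x y, rho x y -> joined e s (W x) (W y)) ->
  path rho y0 q -> uniq (y0 :: q) ->
  (forall x, x \in q -> 2 * s <= #|W x :\: F|) ->
  hits e s win (W (last y0 q)) -> Y \subset W y0 :\: F -> s <= #|Y| ->
  exists y u r, [/\ y \in Y, u \in win, path e y (rcons r u),
    size r = size q
    & uniq (y :: r) /\ forall v, v \in y :: r ->
        v \notin F /\ exists2 x, x \in y0 :: q & v \in W x].
Proof.
move=> se Wdisj Wj; elim: q y0 Y => [|z q IH] y0 Y /=.
  move=> _ _ _ hw YW sY.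
  have [|u [y [uw yY euy]]] := hw _ _ sY; first exact: subset_trans YW (subsetDl _ _).
  exists y, u, [::]; split=> //; first by rewrite /= se euy.
  split=> // v; rewrite inE => /eqP->; have := subsetP YW y yY.
  by rewrite inE => /andP[yF yW]; split=> //; exists y0; rewrite ?mem_head.
move=> /andP[yz pq] /andP[y0q uq] big hw YW sY.
pose Z := [set w in W z :\: F | ~~ [forall y in Y, ~~ e y w]].
have YW' : Y \subset W y0 by apply: subset_trans YW (subsetDl _ _).
have miss := joined_miss (Wj _ _ yz) YW' (subsetDl (W z) F) sY.
have sZ : s <= #|Z|.
  have := big z (mem_head _ _).
  rewrite -(cardsID [set w | [forall y in Y, ~~ e y w]] (W z :\: F)).
  rewrite (_ : _ :&: _ = [set w in W z :\: F | [forall y in Y, ~~ e y w]]); last first.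
    by apply/setP => w; rewrite !inE.
  rewrite (_ : _ :\: [set w | _] = Z); first by move: miss; lia.
  by apply/setP => w; rewrite !inE andbC.
have ZW : Z \subset W z :\: F by apply/subsetP => w; rewrite inE => /andP[].
have [|w [u [r [wZ uw pr sr [ur hr]]]]] := IH z Z pq uq _ hw ZW sZ.
  by move=> x xq; apply: big; rewrite inE xq orbT.
move: (wZ); rewrite inE negb_forall => /andP[_ /existsP[y]].
rewrite negb_imply negbK => /andP[yY eyw].
have := subsetP YW y yY; rewrite inE => /andP[yF yW].
exists y, u, (w :: r); split=> //.
- by rewrite /= eyw.
- by rewrite /= sr.
split.
- rewrite ur andbT; apply/negP => /hr[_ [x xq yWx]].
  by have E := Wdisj _ _ _ yW yWx; rewrite -E (negbTE y0q) in xq.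
- move=> v; rewrite inE => /predU1P[->|/hr[vF [x xq vx]]].
    by split=> //; exists y0; rewrite ?mem_head.
  by split=> //; exists x; rewrite // inE xq orbT.
Qed.

Lemma connector (V N : finType) (e : rel V) (rho : rel N)
    (W : N -> {set V}) (s : nat) (F : {set V}) (win1 win2 : seq V) y1 y2 :
  symmetric e -> (forall v x y, v \in W x -> v \in W y -> x = y) ->
  (forall x y, rho x y -> joined e s (W x) (W y)) ->
  connect rho y1 y2 -> (forall x, connect rho y1 x -> 2 * s <= #|W x :\: F|) ->
  hits e s win1 (W y1) -> hits e s win2 (W y2) ->
  exists v u r, [/\ v \in win1, u \in win2, path e v (rcons r u),
    size r <= #|N|
    & uniq r /\ forall x, x \in r -> x \notin F /\ exists y, x \in W y].
Proof.
move=> se Wdisj Wj /connectP[q0 pq0 ->] big h1 h2.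
(* A simple route through the nodes gives a connector of at most [#|N|] inner vertices. *)
move: h2; case: (shortenP pq0) => q pq uq _ h2.
have con x : x \in y1 :: q -> connect rho y1 x by apply: path_connect.
pose Y := [set y in W y1 :\: F | has (e^~ y) win1].
have sY : s <= #|Y|.
  have := hits_miss h1 (subsetDl (W y1) F); have := big y1 (connect0 _ _).
  by rewrite -/Y; lia.
have [||y [u [r [yY uw pr sr [ur hr]]]]] :=
  @connector_from _ _ _ _ _ _ F win2 q y1 Y se Wdisj Wj pq uq _ h2 _ sY.
- by move=> x xq; apply: big; apply: con; rewrite inE xq orbT.
- by apply/subsetP => y; rewrite inE => /andP[].
move: yY; rewrite inE => /andP[_ /hasP[v vw evy]].
exists v, u, (y :: r); split=> //.
- by rewrite /= evy.
- rewrite /= sr -[(size q).+1]/(size (y1 :: q)) -(card_uniqP uq).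
  exact: max_card.
- by split=> // x /hr[xF [z _ xz]]; split=> //; exists z.
Qed.

Lemma mem_drop_split (V : eqType) (k : nat) (Q : seq V) v : v \in drop k Q ->
  exists Q1 Q2, Q = Q1 ++ v :: Q2 /\ k <= size Q1.
Proof.
move=> vd; have kQ : k <= size Q.
  by rewrite leqNgt; apply: contraTN vd => /ltnW h; rewrite drop_oversize.
case/splitPr: vd (cat_take_drop k Q) => a b <-.
exists (take k Q ++ a), b; rewrite -catA; split=> //.
by rewrite size_cat size_takel // leq_addr.
Qed.

Lemma mem_take_split (V : eqType) (k : nat) (Q : seq V) v : v \in take k Q ->
  exists Q1 Q2, Q = Q1 ++ v :: Q2 /\ size Q1 < k.
Proof.
move=> vd; have := size_take_min k Q.
case/splitPr: vd (cat_take_drop k Q) => a b <- sz.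
exists a, (b ++ drop k Q); rewrite -catA; split=> //.
by move: sz; rewrite size_cat /=; lia.
Qed.

(** A connector leaves [Q] at one of its last [w] vertices and enters [p] at one of its first [w];
    what lies beyond is cut away. Hence at most [2 * w] vertices are lost, and the beginning of [Q]
    and the end of [p] survive. *)
Lemma chain_step (V N : finType) (e : rel V) (rho : rel N)
    (W : N -> {set V}) (s w : nat) (Q p : seq V) y1 y2 :
  symmetric e -> (forall v x y, v \in W x -> v \in W y -> x = y) ->
  (forall x y, rho x y -> joined e s (W x) (W y)) ->
  connect rho y1 y2 ->
  (forall x, connect rho y1 x -> 2 * s <= #|W x :\: [set v in Q]|) ->
  hits e s (drop (size Q - w) Q) (W y1) -> hits e s (take w p) (W y2) ->
  sorted e Q -> uniq Q -> sorted e p -> uniq p -> (forall v, v \in p -> v \notin Q) ->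
  (forall v x, v \in p -> v \notin W x) -> w <= size Q -> w <= size p ->
  exists Q', [/\ sorted e Q', uniq Q',
    take (size Q - w) Q' = take (size Q - w) Q,
    drop (size Q' - (size p - w)) Q' = drop w p
    & [/\ size Q + size p <= size Q' + 2 * w,
          size Q' <= size Q + size p + #|N|,
          forall v, v \in Q' -> [\/ v \in Q, v \in p | exists x, v \in W x]
        & forall x, #|W x :\: [set v in Q]| <= #|W x :\: [set v in Q']| + #|N|]].
Proof.
move=> se Wdisj Wj con big hQ hp sQ uQ sp up pQ pW wQ wp.
have [v [u [r [vQ uP pr sr [ur hr]]]]] := connector se Wdisj Wj con big hQ hp.
have [Q1 [Q2 [EQ sQ1]]] := mem_drop_split vQ.
have [p1 [p2 [Ep sp1]]] := mem_take_split uP.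
have rQ x : x \in r -> x \notin Q by move=> /hr[]; rewrite inE.
have rp x : x \in r -> x \notin p.
  by move=> /hr[_ [y xy]]; apply: contraL xy => /pW.
have dp : drop (size p1) p = u :: p2 by rewrite Ep drop_size_cat.
have tQ : take (size Q1).+1 Q = rcons Q1 v.
  by rewrite EQ -cat_rcons take_size_cat ?size_rcons.
pose P := rcons Q1 v ++ r; exists (P ++ drop (size p1) p).
have sP : size P = (size Q1).+1 + size r by rewrite size_cat size_rcons.
have szQ : size Q = (size Q1 + size Q2).+1 by rewrite EQ size_cat /= addnS.
have szp : size p = (size p1 + size p2).+1 by rewrite Ep size_cat /= addnS.
have inQ x : x \in rcons Q1 v -> x \in Q by rewrite -tQ; apply: mem_take.
have inp x : x \in drop (size p1) p -> x \in p by apply: mem_drop.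
split.
- rewrite /P dp cat_rcons -catA /= sorted_cat_cons.
  move: sQ; rewrite EQ sorted_cat_cons => /andP[-> _] /=.
  rewrite -cat_rcons cat_path pr last_rcons /=.
  by move: sp; rewrite Ep sorted_cat_cons => /andP[].
- rewrite /P !cat_uniq -{1}tQ take_uniq // ur drop_uniq // !andbT /=.
  apply/andP; split.
    by apply/hasPn => x /rQ; apply: contra => /inQ.
  apply/hasPn => x /inp xp; rewrite mem_cat negb_or.
  apply/andP; split; first by apply: contra (pQ x xp) => /inQ.
  by apply: contraL xp => /rp.
- rewrite /P -catA -tQ takel_cat; last by rewrite size_takel; lia.
  by rewrite take_takel //; lia.
- rewrite drop_cat size_cat size_drop.
  rewrite ifN; last by rewrite -leqNgt; lia.
  by rewrite drop_drop; congr drop; lia.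
split.
- by rewrite size_cat size_drop sP; lia.
- by rewrite size_cat size_drop sP; lia.
- move=> x; rewrite !mem_cat => /orP[/orP[/inQ|/hr[_ ?]]|/inp]; by constructor.
- have cr : #|[set x in r]| <= #|N| by rewrite cardsE (card_uniqP ur).
  move=> x; apply: leq_trans (leq_add (leqnn _) cr).
  rewrite -cardsUI; apply: leq_trans (leq_addr _ _).
  apply: subset_leq_card; apply/subsetP => z; rewrite !inE !mem_cat.
  case/andP=> zQ zx; rewrite zx andbT; case: (boolP (z \in r)) => zr; rewrite ?orbT //= orbF.
  rewrite orbF negb_or; apply/andP; split; first by apply: contra zQ => /inQ.
  by apply: contraL zx => /inp/pW.
Qed.

(** Both end windows attach to the reservoir of the node [py.2], while the path avoids all
    reservoirs. The predicate [ok] will exclude the vertices set aside for the root and its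
    branches. *)
Definition piece (V N : finType) (e : rel V) (rho : rel N) (W : N -> {set V})
    (s w l : nat) (ok : pred V) (y0 : N) (py : seq V * N) : Prop :=
  [/\ sorted e py.1, uniq py.1, size py.1 = l, connect rho y0 py.2
    & [/\ hits e s (take w py.1) (W py.2), hits e s (drop (l - w) py.1) (W py.2),
          forall v, v \in py.1 -> ok v
        & forall v x, v \in py.1 -> v \notin W x]].

(* Pieces are appended to Q until its length is within reach of t, and then the
   last piece is appended.  The windows of Q and of the last piece have length
   l - w, which exceeds the uncertainty on the length of a single piece. *)
Lemma chain_grow (V N : finType) (e : rel V) (rho : rel N) (W : N -> {set V})
    (s w l t : nat) (ok : pred V) (y0 : N) (last_piece : seq V * N)
    (ps : seq (seq V * N)) (Q : seq V) (y : N) :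
  symmetric e -> symmetric rho ->
  (forall v x y, v \in W x -> v \in W y -> x = y) ->
  (forall x y, rho x y -> joined e s (W x) (W y)) ->
  (forall v x, v \in W x -> ok v) ->
  2 * #|N| + 4 * w + 8 * s + 8 <= l ->
  piece e rho W s w l ok y0 last_piece ->
  (forall py, py \in ps -> piece e rho W s w l ok y0 py) ->
  uniq (flatten (unzip1 ps) ++ last_piece.1) ->
  (forall v, v \in Q -> v \notin flatten (unzip1 ps) ++ last_piece.1) ->
  sorted e Q -> uniq Q -> l <= size Q -> (forall v, v \in Q -> ok v) ->
  connect rho y0 y -> hits e s (drop (size Q - w) Q) (W y) ->
  (forall x, connect rho y0 x ->
     2 * s + #|N| * (size ps).+1 <= #|W x :\: [set v in Q]|) ->
  size Q + #|N| + (2 * w + 4 * s + 4) <= t + l ->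
  t + (2 * w + 4 * s + 4) <= size Q + size ps * (l - 2 * w) + l ->
  exists Q', [/\ sorted e Q', uniq Q',
    take (l - w) Q' = take (l - w) Q,
    drop (size Q' - (l - w)) Q' = drop w last_piece.1
    & [/\ t + 4 * s + 4 <= size Q', size Q' + 2 * w + 4 * s + 4 <= t + 2 * l
        & forall v, v \in Q' -> ok v]].
Proof.
move=> se srho Wdisj Wj Wok big hlast.
have con z1 z2 : connect rho y0 z1 -> connect rho y0 z2 -> connect rho z1 z2.
  by rewrite (sym_connect_sym srho y0 z1); apply: connect_trans.
have step (Q1 : seq V) (z : N) (py : seq V * N) k : piece e rho W s w l ok y0 py ->
  (forall v, v \in py.1 -> v \notin Q1) ->
  sorted e Q1 -> uniq Q1 -> l <= size Q1 -> (forall v, v \in Q1 -> ok v) ->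
  connect rho y0 z -> hits e s (drop (size Q1 - w) Q1) (W z) ->
  (forall x, connect rho y0 x ->
     2 * s + #|N| * k.+1 <= #|W x :\: [set v in Q1]|) ->
  exists Q', [/\ sorted e Q', uniq Q', take (l - w) Q' = take (l - w) Q1,
    drop (size Q' - (l - w)) Q' = drop w py.1
    & [/\ size Q1 + l <= size Q' + 2 * w, size Q' <= size Q1 + l + #|N|,
          forall v, v \in Q' -> ok v,
          forall v, v \in Q' -> [\/ v \in Q1, v \in py.1 | exists x, v \in W x]
        & forall x, connect rho y0 x ->
          2 * s + #|N| * k <= #|W x :\: [set v in Q']|]].
  move=> [sp up szp cp [h1 h2 pok pW]] pQ sQ uQ lQ Qok cz hQ avail.
  have av x : connect rho z x -> 2 * s <= #|W x :\: [set v in Q1]|.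
    move=> zx; apply: leq_trans (avail x (connect_trans cz zx)).
    exact: leq_addr.
  have [||Q' [sQ' uQ' tQ' dQ' [n1 n2 inQ' WQ']]] :=
    chain_step se Wdisj Wj (con _ _ cz cp) av hQ h1 sQ uQ sp up pQ pW; [lia|lia|].
  exists Q'; rewrite szp in dQ' n1 n2; split=> //.
    have := congr1 (take (l - w)) tQ'.
    by rewrite !take_takel //; lia.
  split=> //.
    by move=> v /inQ'[/Qok|/pok|[x /Wok]].
  move=> x /avail; have := WQ' x; rewrite mulnS; lia.
elim: ps Q y => [|py ps IH] Q y hps ups Qps sQ uQ lQ Qok cy hQ avail lo hi.
  have [|Q' [sQ' uQ' tQ' dQ' [n1 n2 Q'ok _ _]]] :=
    step Q y last_piece 0 hlast _ sQ uQ lQ Qok cy hQ avail.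
    by move=> v vl; apply: contraL vl => /Qps.
  rewrite mul0n addn0 in hi.
  by exists Q'; split=> //; split=> //; lia.
(* Appending a piece gives a length between [size Q + l - 2 * w] and [size Q + l + #|N|]. If the
   lower bound suffices for [t], the last piece comes now; otherwise [size Q] is still so small that
   the hypothesis on [l] preserves the upper bound on the chain after one more piece. *)
case: (leqP (t + (2 * w + 4 * s + 4)) (size Q + l)) => ht.
  have [||Q' [sQ' uQ' tQ' dQ' [n1 n2 Q'ok _ _]]] :=
    step Q y last_piece 0 hlast _ sQ uQ lQ Qok cy hQ _.
  - move=> v vl; apply: contraL vl => /Qps.
    by rewrite mem_cat negb_or => /andP[].
  - move=> x /avail; rewrite [size _]/= !mulnS; lia.
  by exists Q'; split=> //; split=> //; lia.
have hpy : piece e rho W s w l ok y0 py by apply: hps; rewrite mem_head.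
have [|Q' [sQ' uQ' tQ' dQ' [n1 n2 Q'ok Q'in avail']]] :=
  step Q y py (size ps).+1 hpy _ sQ uQ lQ Qok cy hQ avail.
  move=> v vl; apply: contraL vl => /Qps.
  by rewrite /= !mem_cat !negb_or => /andP[/andP[]].
have [_ _ szp cp [_ h2 _ pW]] := hpy.
have [|||||||Q2 [sQ2 uQ2 tQ2 dQ2 rest]] :=
  IH Q' py.2 _ _ _ sQ' uQ' _ Q'ok cp _ avail' _ _.
- by move=> qz qps; apply: hps; rewrite inE qps orbT.
- by move: ups; rewrite /= -catA cat_uniq => /and3P[].
- move=> v vQ'; apply/negP => vps; case: (Q'in v vQ') => [/Qps|vp|[x vx]].
  + by rewrite /= -catA mem_cat vps orbT.
  + move: ups; rewrite /= -catA cat_uniq => /and3P[_ /hasPn/(_ v vps)].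
    by rewrite vp.
  + move: vps; rewrite mem_cat => /orP[/flattenP[q /mapP[pz pzps ->] vq]|vl].
      have [_ _ _ _ [_ _ _ /(_ v x vq)]] : piece e rho W s w l ok y0 pz.
        by apply: hps; rewrite inE pzps orbT.
      by rewrite vx.
    by case: hlast => _ _ _ _ [_ _ _ /(_ v x vl)]; rewrite vx.
- by lia.
- rewrite (_ : size Q' - w = (l - 2 * w) + (size Q' - (l - w))); last by lia.
  by rewrite -drop_drop dQ' drop_drop (_ : l - 2 * w + w = l - w) //; lia.
- by lia.
- by move: hi; rewrite /= mulSn; lia.
by exists Q2; split=> //; rewrite tQ2.
Qed.

(** * Branchings of logarithmic depth *)

Definition expand (V : finType) (e : rel V) (U B : {set V}) : {set V} :=
  B :|: [set y in U | [exists x in B, e x y]].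

(** The ball of radius [i] around [S], where every step leads into [U]; [S] itself need not lie in
    [U]. *)
Definition reach (V : finType) (e : rel V) (U S : {set V}) (i : nat) : {set V} :=
  iter i (expand e U) S.

Lemma reachU (V : finType) (e : rel V) (U S S' : {set V}) i :
  reach e U (S :|: S') i = reach e U S i :|: reach e U S' i.
Proof.
elim: i => //= i ->; apply/setP => y; rewrite !inE.
have -> : [exists x in reach e U S i :|: reach e U S' i, e x y] =
    [exists x in reach e U S i, e x y] || [exists x in reach e U S' i, e x y].
  apply/exists_inP/orP => [[x]|[/exists_inP[x]|/exists_inP[x]]].
  - by rewrite inE => /orP[xS|xS] exy; [left|right]; apply/exists_inP; exists x.
  - by move=> xS exy; exists x; rewrite // inE xS.
  - by move=> xS exy; exists x; rewrite // inE xS orbT.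
by rewrite andb_orr; do !case: (y \in _) => //=; rewrite ?orbT.
Qed.

(** A vertex first reached in step [i.+1] has a predecessor first reached one step earlier. The path
    is simple since its last vertex lies outside the ball that contains the others. *)
Lemma layer_path (V : finType) (e : rel V) (U : {set V}) u i x :
  x \in reach e U [set u] i.+1 -> x \notin reach e U [set u] i ->
  exists q, [/\ path e u q, last u q = x, size q = i.+1, uniq (u :: q)
    & forall v, v \in q -> v \in U /\ v \in reach e U [set u] i.+1].
Proof.
have mono k z : z \in reach e U [set u] k -> z \in reach e U [set u] k.+1.
  by move=> zk; rewrite /= inE zk.
have uk k : u \in reach e U [set u] k.
  by elim: k => [|k IH]; [rewrite inE|apply: mono].
elim: i x => [|i IH] x xi xni.
  move: (xi) (xni); rewrite /= !inE => /orP[->//|/andP[xU /exists_inP[y]]].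
  rewrite inE => /eqP-> eux xu; exists [:: x].
  rewrite /= eux !inE eq_sym xu; split=> // v; rewrite inE => /eqP->; split=> //.
move: (xi) (xni); rewrite [in X in X -> _]/= inE => /orP[->//|].
rewrite inE => /andP[xU /exists_inP[y yi eyx]] _.
have yni : y \notin reach e U [set u] i.
  apply: contra xni => yi'; rewrite /= !inE xU.
  by apply/orP; right; apply/exists_inP; exists y.
have [q [pq lq sq uq hq]] := IH y yi yni.
exists (rcons q x); split.
- by rewrite rcons_path pq lq.
- by rewrite last_rcons.
- by rewrite size_rcons sq.
- rewrite -rcons_cons rcons_uniq uq andbT inE negb_or; apply/andP; split.
    by apply: contraNneq xni => ->.
  by apply: contra xni => /hq[].
- move=> v; rewrite mem_rcons inE => /predU1P[->|/hq[vU vi]]; split=> //.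
  exact: mono.
Qed.

(** All leaves are ends of paths with the same number [h] of edges, and they lie on one side, so one
    joined pair applies to all of them. *)
Definition branching (V : finType) (e : rel V) (s h : nat) (X Y L : {set V}) u
    : Prop :=
  [/\ s <= #|L|, L \subset X \/ L \subset Y
    & forall x, x \in L -> exists q, [/\ path e u q, last u q = x, size q = h,
        uniq (u :: q) & forall v, v \in q -> v \in X :|: Y]].

Lemma exists_subset_card (V : finType) (A : {set V}) k : k <= #|A| ->
  exists2 B : {set V}, B \subset A & #|B| = k.
Proof.
move=> kA; exists [set x in take k (enum A)].
  by apply/subsetP => x; rewrite inE => /mem_take; rewrite mem_enum.
rewrite cardsE (card_uniqP _) ?take_uniq ?enum_uniq //.
by rewrite size_takel // -cardE.
Qed.

(* Halving: if a set of 2^j roots reaches many vertices, so does one of its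
   halves, and one further step makes up for the loss.  For the first radius at
   which a single root u reaches 2s vertices, one of two consecutive layers
   around u is large. *)
Lemma branching_root (V : finType) (e : rel V) (X Y S : {set V}) (s j : nat) :
  symmetric e -> 0 < s -> [disjoint X & Y] -> [disjoint S & X :|: Y] ->
  8 * s <= #|X| -> 8 * s <= #|Y| -> joined e s S Y -> joined e s X Y ->
  s <= #|S| -> #|S| <= 2 ^ j ->
  exists u h L, [/\ u \in S, h <= j + 2 & branching e s h X Y L u].
Proof.
move=> se s0 XY SXY bigX bigY jSY jXY sS Sj.
set U := X :|: Y.
have large (A B C : {set V}) : joined e s A B -> C \subset A -> s <= #|C| ->
    8 * s <= #|B| -> B \subset U -> 7 * s <= #|[set y in U | [exists x in C, e x y]]|.
  move=> jAB CA sC bigB BU; have := joined_miss jAB CA (subxx B) sC.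
  have : #|B| <= #|[set y in B | [forall x in C, ~~ e x y]]|
      + #|[set y in U | [exists x in C, e x y]]|.
    rewrite -cardsUI; apply: leq_trans (leq_addr _ _); apply: subset_leq_card.
    apply/subsetP => y yB; rewrite !inE yB /= -(in_setU y X Y) (subsetP BU) //=.
    case: (boolP [forall x in C, ~~ e x y]) => //=.
    rewrite negb_forall => /existsP[x]; rewrite negb_imply negbK => h.
    by apply/existsP; exists x.
  lia.
have grow (B : {set V}) : 2 * s <= #|B :&: U| -> 7 * s <= #|expand e U B :&: U|.
  move=> hB.
  have sub (C : {set V}) : C \subset B ->
      #|[set y in U | [exists x in C, e x y]]| <= #|expand e U B :&: U|.
    move=> CB; apply: subset_leq_card; apply/subsetP => y.
    rewrite inE => /andP[yU /exists_inP[x xC exy]].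
    rewrite in_setI yU andbT !inE; apply/orP; right; rewrite -in_setU yU.
    by apply/exists_inP; exists x => //; apply: (subsetP CB).
  have : #|B :&: U| <= #|B :&: X| + #|B :&: Y|.
    by rewrite setIUr; apply: leq_card_setU.
  case: (leqP s #|B :&: X|) => hX hXY.
    apply: leq_trans (large _ _ _ jXY (subsetIr B X) hX bigY (subsetUr _ _)) _.
    exact/sub/subsetIl.
  have hY : s <= #|B :&: Y| by lia.
  apply: leq_trans (large _ _ _ (joined_sym se jXY) (subsetIr B Y) hY bigX (subsetUl _ _)) _.
  exact/sub/subsetIl.
(* One more step brings the ball to at least [7 * s] vertices, so the ball around one of the halves
   still has at least [2 * s]. *)
have halving k i (S1 : {set V}) : 0 < #|S1| -> #|S1| <= 2 ^ k ->
    2 * s <= #|reach e U S1 i :&: U| ->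
    exists2 u, u \in S1 & 2 * s <= #|reach e U [set u] (i + k) :&: U|.
  elim: k i S1 => [|k IH] i S1 S10 S1k hS1.
    have /cards1P[u Eu] : #|S1| == 1 by rewrite eqn_leq S10 S1k.
    by exists u; rewrite ?Eu ?inE // addn0 -Eu.
  have hS1' := grow _ hS1; rewrite -[expand e U _]/(reach e U S1 i.+1) in hS1'.
  rewrite -addSnnS; case: (leqP #|S1| (2 ^ k)) => hk.
    by apply: IH => //; lia.
  have [S2 S21 cS2] := exists_subset_card (ltnW hk).
  have cS12 : #|S1 :\: S2| = #|S1| - 2 ^ k by rewrite cardsD (setIidPr S21) cS2.
  have : #|reach e U S1 i.+1 :&: U| <=
      #|reach e U S2 i.+1 :&: U| + #|reach e U (S1 :\: S2) i.+1 :&: U|.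
    rewrite -{1}(setID S1 S2) (setIidPr S21) reachU setIUl; exact: leq_card_setU.
  case: (leqP (2 * s) #|reach e U S2 i.+1 :&: U|) => h2 h12.
    have [||u uS2 hu] := IH i.+1 S2 _ _ h2; rewrite ?cS2 ?expn_gt0 //.
    by exists u => //; apply: (subsetP S21).
  have [|||u uS2 hu] := IH i.+1 (S1 :\: S2).
  - by rewrite cS12; lia.
  - by rewrite cS12; move: S1k; rewrite expnS; lia.
  - by lia.
  by exists u => //; move: uS2; rewrite inE => /andP[].
have hS : 2 * s <= #|reach e U S 1 :&: U|.
  apply: leq_trans (_ : 7 * s <= _); first by lia.
  apply: leq_trans (large _ _ _ jSY (subxx S) sS bigY (subsetUr _ _)) _.
  apply: subset_leq_card; apply/subsetP => y; rewrite inE => /andP[yU hy].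
  by rewrite in_setI yU andbT /= inE; apply/orP; right; rewrite inE yU.
have [|u uS hu] := halving j 1 S _ Sj hS; first by lia.
have ex_i : exists i, 2 * s <= #|reach e U [set u] i :&: U| by exists (1 + j).
case: (ex_minnP ex_i) => -[|i] hi imin.
  move: hi; rewrite (_ : _ :&: _ = set0) ?cards0 ?muln_eq0; first by lia.
  apply/setP => v; rewrite !inE; case: eqP => //= ->; apply/negbTE.
  by rewrite -in_setU (disjointFr SXY uS).
have ij : i.+1 <= 1 + j by apply: imin.
have hi0 : #|reach e U [set u] i :&: U| < 2 * s.
  by rewrite ltnNge; apply/negP => /imin; rewrite ltnn.
have hi2 := grow _ hi; rewrite -[expand e U _]/(reach e U [set u] i.+2) in hi2.
(* Within [U], the ball of radius [i] has fewer than [2 * s] vertices and that of radius [i.+2] at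
   least [7 * s], so one of the two layers in between has at least [2 * s]. *)
have [k [ki hk]] : exists k, k <= i.+1 /\
    2 * s <= #|(reach e U [set u] k.+1 :\: reach e U [set u] k) :&: U|.
  have diff k : #|reach e U [set u] k.+1 :&: U| <= #|reach e U [set u] k :&: U| +
      #|(reach e U [set u] k.+1 :\: reach e U [set u] k) :&: U|.
    rewrite -(cardsID (reach e U [set u] k)) leq_add // subset_leq_card //.
      by apply/subsetP => v; rewrite !in_setI => /andP[/andP[_ ->] ->].
    by apply/subsetP => v; rewrite !(in_setI, in_setD) => /and3P[-> -> ->].
  have := diff i; have := diff i.+1.
  case: (leqP (2 * s) #|(reach e U [set u] i.+1 :\: reach e U [set u] i) :&: U|) => h.
    by exists i; split.
  by exists i.+1; split=> //; lia.
set D := (_ :\: _) in hk.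
have DX : #|D :&: U| <= #|D :&: X| + #|D :&: Y|.
  by rewrite setIUr; apply: leq_card_setU.
have layer x : x \in D -> exists q, [/\ path e u q, last u q = x, size q = k.+1,
    uniq (u :: q) & forall v, v \in q -> v \in U].
  rewrite inE => /andP[xn xk]; have [q [pq lq sq uq hq]] := layer_path xk xn.
  by exists q; split=> // v /hq[].
exists u, k.+1; have kj : k.+1 <= j + 2 by lia.
case: (leqP s #|D :&: X|) => hX.
  exists (D :&: X); split=> //; split=> //; first by left; apply: subsetIr.
  by move=> x; rewrite inE => /andP[/layer].
exists (D :&: Y); split=> //; split; [lia|by right; apply: subsetIr|].
by move=> x; rewrite inE => /andP[/layer].
Qed.

Lemma few_missing (V I : finType) (e : rel V) (s : nat) (A B L : {set V})
    (f : I -> V) :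
  injective f -> joined e s A B -> L \subset A -> s <= #|L| ->
  (forall i, f i \in B) -> #|[set i | [forall x in L, ~~ e x (f i)]]| < s.
Proof.
move=> fI jAB LA sL fB; have sub : f @: [set: I] \subset B.
  by apply/subsetP => _ /imsetP[i _ ->].
rewrite -(card_imset _ fI); apply: leq_ltn_trans (joined_miss jAB LA sub sL).
apply: subset_leq_card; apply/subsetP => _ /imsetP[i + ->].
by rewrite !inE imset_f ?inE.
Qed.

(** * Closing a segment of a path into a cycle *)

Lemma phase_path (V : Type) (e : rel V) (phi : V -> bool) x p :
  bipartite e phi -> path e x p -> phi (last x p) = phi x (+) odd (size p).
Proof.
move=> be; elim: p x => [|y p IH] x /=; first by rewrite addbF.
by case/andP => /be hy /IH ->; rewrite hy addNb addbN.
Qed.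

Lemma path_infix (V : eqType) (e : rel V) (x0 : V) (Q : seq V) i t :
  sorted e Q -> uniq Q -> i + t < size Q ->
  exists m, [/\ path e (nth x0 Q i) m, last (nth x0 Q i) m = nth x0 Q (i + t),
    size m = t, uniq (nth x0 Q i :: m) & {subset nth x0 Q i :: m <= Q}].
Proof.
move=> sQ uQ itQ; have iQ : i < size Q by lia.
have E : drop i Q = nth x0 Q i :: drop i.+1 Q by rewrite (drop_nth x0).
have sz : size (take t (drop i.+1 Q)) = t by rewrite size_takel ?size_drop; lia.
have Et : nth x0 Q i :: take t (drop i.+1 Q) = take t.+1 (drop i Q) by rewrite E.
exists (take t (drop i.+1 Q)); split=> //.
- have : sorted e (take t.+1 (drop i Q)) by rewrite take_sorted // drop_sorted.
  by rewrite -Et.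
- rewrite (last_nth x0) sz Et nth_take // nth_drop //.
- by rewrite Et take_uniq // drop_uniq.
- by rewrite Et => v /mem_take/mem_drop.
Qed.

(* The positions i and i + t range over the two windows of Q; those of the
   right parity are joined to the leaves of the two branches at the root u,
   with fewer than s exceptions for each branch. *)
Lemma close_cycle (V : finType) (e : rel V) (phi : V -> bool) (s w t h1 h2 : nat)
    (A B X1 Y1 X2 Y2 L1 L2 : {set V}) (u : V) (Q : seq V) :
  symmetric e -> bipartite e phi -> (forall x, x \in A -> phi x) ->
  (forall x, x \in B -> ~~ phi x) -> joined e s A B ->
  u \in A -> X1 :|: X2 \subset A -> Y1 :|: Y2 \subset B ->
  0 < s -> branching e s h1 X1 Y1 L1 u -> branching e s h2 X2 Y2 L2 u ->
  [disjoint X1 :|: Y1 & X2 :|: Y2] ->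
  (forall v, v \in Q -> [&& v != u, v \notin X1 :|: Y1 & v \notin X2 :|: Y2]) ->
  sorted e Q -> uniq Q ->
  (forall v, v \in take w Q -> v \in A :|: B) ->
  (forall v, v \in drop (size Q - w) Q -> v \in A :|: B) ->
  4 * s + 4 <= w -> w <= size Q -> t + 4 * s + 4 <= size Q ->
  size Q + 4 * s + 4 <= t + 2 * w -> ~~ odd (t + h1 + h2) ->
  exists c, [/\ uniq c, size c = t + h1 + h2 + 2 & cycle e c].
Proof.
move=> se be fA fB jAB uA XA YB s0 br1 br2 dXY Qok sQ uQ Qw Qw' sw wQ tQ tQ' par.
have phiA v : v \in A :|: B -> phi v -> v \in A.
  by rewrite inE => /orP[//|/fB/negbTE->].
have phiB v : v \in A :|: B -> ~~ phi v -> v \in B.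
  by rewrite inE => /orP[/fA->|//].
have phQ i k : i + k < size Q -> phi (nth u Q (i + k)) = phi (nth u Q i) (+) odd k.
  by move=> ik; have [m [pm <- <- _ _]] := path_infix u sQ uQ ik; apply: phase_path be pm.
(* The phase of [u] is [true], so the leaves at depth [h1] can only have neighbours of phase
   [odd h1]. Shifting the first position by at most one gives it this phase. *)
have [i1 [i1w i1Q i1lo phi1]] : exists i1, [/\ i1 + 4 * s <= w,
    i1 + 4 * s + t <= size Q, size Q - w <= i1 + t
    & forall k, i1 + k < size Q -> phi (nth u Q (i1 + k)) = odd h1 (+) odd k].
  pose i0 := size Q - w - t.
  have [d d1 dE] : exists2 d : nat, d <= 1 & odd d = phi (nth u Q i0) (+) odd h1.
    by case: (_ (+) _); [exists 1|exists 0].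
  have i0E : i0 = size Q - w - t by [].
  clearbody i0; exists (i0 + d).
  split; [clear par dE; lia|clear par dE; lia|clear par dE; lia|] => k ik.
  rewrite phQ // phQ ?dE; last by clear par dE; lia.
  by case: (phi _) (odd h1) => [] [].
(* Steps of two keep the phases along [f] and [g] constant; by the parity of [t + h1 + h2] the
   vertices [g k] fit the second branch. *)
pose f (k : 'I_(2 * s)) := nth u Q (i1 + 2 * k).
pose g (k : 'I_(2 * s)) := nth u Q (i1 + 2 * k + t).
have kb (k : 'I_(2 * s)) : i1 + 2 * k + t < size Q.
  by have := ltn_ord k; clear par; lia.
have kb' (k : 'I_(2 * s)) : i1 + 2 * k < size Q by have := kb k; clear par; lia.
have fI : injective f.
  move=> k k' /eqP; rewrite nth_uniq // => /eqP h; apply: val_inj => /=; clear par; lia.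
have gI : injective g.
  move=> k k' /eqP; rewrite nth_uniq // => /eqP h; apply: val_inj => /=; clear par; lia.
have fAB k : f k \in A :|: B.
  apply: Qw; rewrite /f -(@nth_take w); last by have := ltn_ord k; clear par; lia.
  by rewrite mem_nth // size_takel //; have := ltn_ord k; clear par; lia.
have gAB k : g k \in A :|: B.
  apply: Qw'; rewrite /g.
  rewrite (_ : _ + t = size Q - w + (i1 + 2 * k + t - (size Q - w))); last by clear par; lia.
  rewrite -(nth_drop (size Q - w)) mem_nth // size_drop.
  by rewrite ltn_sub2rE // (leq_trans i1lo) //; clear par; lia.
have phif k : phi (f k) = odd h1 by rewrite /f phi1 // mul2n odd_double addbF.
have phig k : phi (g k) = odd h2.
  rewrite /g -addnA phi1; last by rewrite addnA.
  rewrite oddD mul2n odd_double addFb.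
  by move: par; rewrite !oddD; case: (odd t) (odd h1) (odd h2) => [] [] [].
have few h X Y L (F : 'I_(2 * s) -> V) : branching e s h X Y L u -> X \subset A ->
    Y \subset B -> injective F -> (forall k, F k \in A :|: B) ->
    (forall k, phi (F k) = odd h) ->
    #|[set k | [forall x in L, ~~ e x (F k)]]| < s.
  move=> [sL LXY hL] XA' YB' FI FAB Fphi.
  have /card_gt0P[x xL] : 0 < #|L| by apply: leq_trans sL.
  have [q [pq lq sq _ _]] := hL x xL.
  have := phase_path be pq; rewrite lq sq (fA u uA) addTb => phix.
  case: LXY => [LX|LY].
    have LA := subset_trans LX XA'; apply: (few_missing FI jAB LA sL) => k.
    by apply: phiB => //; rewrite Fphi -phix fA // (subsetP LA).
  have LB := subset_trans LY YB'.
  apply: (few_missing FI (joined_sym se jAB) LB sL) => k.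
  by apply: phiA => //; rewrite Fphi -[odd h]negbK -phix fB // (subsetP LB).
have [X1A X2A] : X1 \subset A /\ X2 \subset A by apply/andP; rewrite -subUset.
have [Y1B Y2B] : Y1 \subset B /\ Y2 \subset B by apply/andP; rewrite -subUset.
have few1 := few _ _ _ _ _ br1 X1A Y1B fI fAB phif.
have few2 := few _ _ _ _ _ br2 X2A Y2B gI gAB phig.
(* Among the [2 * s] positions fewer than [s] fail for each branch. *)
have [k] : exists k, k \notin [set k | [forall x in L1, ~~ e x (f k)]]
    :|: [set k | [forall x in L2, ~~ e x (g k)]].
  apply/existsP; rewrite -negb_forall; apply/forallP => all_bad.
  have := leq_of_leqif (leq_card_setU [set k | [forall x in L1, ~~ e x (f k)]]
    [set k | [forall x in L2, ~~ e x (g k)]]).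
  rewrite (_ : _ :|: _ = setT); last by apply/setP => k; rewrite all_bad inE.
  rewrite cardsT card_ord leqNgt => /negP[].
  by apply: leq_trans (leq_add few1 (ltnW few2)) _; rewrite mul2n addnn.
rewrite !inE negb_or => /andP[/forallPn[x1 +] /forallPn[x2 +]].
rewrite negb_imply negbK => /andP[x1L e1]; rewrite negb_imply negbK => /andP[x2L e2].
have [p1 [pp1 lp1 sp1 up1 hp1]] : exists q, [/\ path e u q, last u q = x1,
  size q = h1, uniq (u :: q) & forall v, v \in q -> v \in X1 :|: Y1].
  by case: br1 => _ _; apply.
have [p2 [pp2 lp2 sp2 up2 hp2]] : exists q, [/\ path e u q, last u q = x2,
  size q = h2, uniq (u :: q) & forall v, v \in q -> v \in X2 :|: Y2].
  by case: br2 => _ _; apply.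
have [m [pm lm sm um mQ]] := path_infix u sQ uQ (kb k).
(* The root, the first branch, [t + 1] vertices of [Q], and the second branch backwards. *)
exists (u :: p1 ++ (f k :: m) ++ rev p2); split.
- have dis x : x \in p1 -> x \notin p2.
    by move=> /hp1 x1X; apply/negP => /hp2; rewrite (disjointFr dXY x1X).
  have [u1 up1'] : u \notin p1 /\ uniq p1 by apply/andP.
  have [u2 up2'] : u \notin p2 /\ uniq p2 by apply/andP.
  have um' : u \notin f k :: m by apply/negP => /mQ/Qok; rewrite eqxx.
  rewrite cons_uniq mem_cat (negbTE u1) mem_cat (negbTE um') mem_rev u2.
  rewrite cat_uniq cat_uniq up1' um rev_uniq up2' andbT !andTb; apply/andP; split.
    apply/hasPn => x; rewrite mem_cat mem_rev => /orP[/mQ/Qok/and3P[_ + _]|].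
      by apply: contra => /hp1.
    by apply: contraL => /dis.
  by apply/hasPn => x; rewrite mem_rev => /hp2 xX; apply/negP => /mQ/Qok; rewrite xX !andbF.
- by rewrite /= size_cat /= size_cat size_rev sp1 sp2 sm; clear; lia.
rewrite /= rcons_cat cat_path pp1 lp1 /= e1 /= rcons_cat cat_path pm lm /=.
rewrite -rev_cons (_ : u :: p2 = belast u (rcons p2 (g k))); last by rewrite belast_rcons.
rewrite -[nth _ _ _]/(g k) -{1}(last_rcons u p2 (g k)) rev_path.
rewrite (eq_path (e' := e)); last by move=> y z; rewrite se.
by rewrite rcons_path pp2 lp2.
Qed.

(** * Phases, the bipartite double cover and pieces of paths *)

Definition cross (V : Type) (e : rel V) (phi : V -> bool) : rel V :=
  fun x y => e x y && (phi x != phi y).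

Lemma cross_sym (V : Type) (e : rel V) (phi : V -> bool) :
  symmetric e -> symmetric (cross e phi).
Proof. by move=> se x y; rewrite /cross se eq_sym. Qed.

Lemma cross_bipartite (V : Type) (e : rel V) (phi : V -> bool) (b : bool) :
  bipartite (cross e phi) (fun v => phi v == b).
Proof. by move=> x y /andP[_]; case: (phi x) (phi y) b => [] [] []. Qed.

Lemma cross_joined (V : finType) (e : rel V) (phi : V -> bool) (b : bool) s
    (A B : {set V}) :
  joined e s A B -> (forall x, x \in A -> phi x = b) ->
  (forall x, x \in B -> phi x = ~~ b) -> joined (cross e phi) s A B.
Proof.
move=> /joinedP jAB fA fB; apply/joinedP => X Y XA YB sX sY.
have [x [y [xX yY exy]]] := jAB X Y XA YB sX sY; exists x, y; split=> //.
rewrite /cross exy (fA x) ?(subsetP XA) // (fB y) ?(subsetP YB) //.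
by case: b {fA fB}.
Qed.

(** The path alternates, so a window of [2 * s] vertices contains at least [s] vertices of [A], and
    [A] is joined to [W]. *)
Lemma window_hits (V : finType) (e : rel V) (phi : V -> bool) (b : bool) s
    (win : seq V) (A B W : {set V}) :
  joined e s A W -> sorted (cross e phi) win -> uniq win -> size win = 2 * s ->
  {subset win <= A :|: B} -> (forall x, x \in A -> phi x = b) ->
  (forall x, x \in B -> phi x = ~~ b) -> (forall x, x \in W -> phi x = ~~ b) ->
  hits (cross e phi) s win W.
Proof.
move=> jAW sw uw szw inw fA fB fW Y YW sY.
have /joinedP jx := cross_joined jAW fA fW.
pose X := [set v in win | phi v == b].
have XA : X \subset A.
  apply/subsetP => v; rewrite inE => /andP[/inw]; rewrite inE => /orP[//|/fB->].
  by case: b {fA fB fW jx X}.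
have sX : s <= #|X|.
  have := count_phase_bounds (@cross_bipartite _ e phi b) sw.
  rewrite szw mul2n doubleK => /andP[h _]; apply: leq_trans h _.
  rewrite -size_filter -(card_uniqP (filter_uniq _ uw)).
  by apply: subset_leq_card; apply/subsetP => v; rewrite mem_filter !inE andbC.
have [x [y [xX yY exy]]] := jx X Y XA YW sX sY.
by exists x, y; split=> //; move: xX; rewrite inE => /andP[].
Qed.

(** Removing each root found and searching again yields [s] roots that branch into the first pair; a
    further search among these finds one that also branches into the second. *)
Lemma two_branchings (V : finType) (e : rel V) (X1 Y1 X2 Y2 S : {set V}) (s j : nat) :
  symmetric e -> 0 < s -> [disjoint X1 & Y1] -> [disjoint S & X1 :|: Y1] ->
  [disjoint X2 & Y2] -> [disjoint S & X2 :|: Y2] ->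
  8 * s <= #|X1| -> 8 * s <= #|Y1| -> 8 * s <= #|X2| -> 8 * s <= #|Y2| ->
  joined e s S Y1 -> joined e s X1 Y1 -> joined e s S Y2 -> joined e s X2 Y2 ->
  2 * s <= #|S| -> #|V| <= 2 ^ j ->
  exists u h1 h2 L1 L2, [/\ u \in S, h1 <= j + 2, h2 <= j + 2,
    branching e s h1 X1 Y1 L1 u & branching e s h2 X2 Y2 L2 u].
Proof.
move=> se s0 XY1 SXY1 XY2 SXY2 bX1 bY1 bX2 bY2 jSY1 jXY1 jSY2 jXY2 sS Vj.
have Gk k : k <= s -> exists G : {set V}, [/\ G \subset S, #|G| = k
    & forall u, u \in G -> exists h L, h <= j + 2 /\ branching e s h X1 Y1 L u].
  elim: k => [|k IH] ks; first by exists set0; rewrite sub0set cards0; split=> // u; rewrite inE.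
  have [G [GS cG hG]] := IH (ltnW ks).
  have cSG : #|S :\: G| = #|S| - k by rewrite cardsD (setIidPr GS) cG.
  have [||||u [h [L [uS hj br]]]] :=
    @branching_root _ e X1 Y1 (S :\: G) s j se s0 XY1 _ bX1 bY1 _ jXY1.
  - by apply: disjointWl SXY1; apply: subsetDl.
  - by apply: joined_sub jSY1; [apply: subsetDl|].
  - by rewrite cSG; lia.
  - by apply: leq_trans Vj; apply: max_card.
  move: uS; rewrite inE => /andP[uG uS].
  exists (u |: G); split; first by rewrite subUset sub1set uS.
    by rewrite cardsU1 uG cG.
  by move=> v; rewrite !inE => /predU1P[->|/hG //]; exists h, L.
have [G [GS sG hG]] := Gk s (leqnn s).
have [||||u [h [L [uG hj br]]]] := @branching_root _ e X2 Y2 G s j se s0 XY2 _ bX2 bY2 _ jXY2.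
- exact: disjointWl SXY2.
- exact: joined_sub jSY2.
- by rewrite sG.
- by apply: leq_trans Vj; apply: max_card.
have [h1 [L1 [hj1 br1]]] := hG u uG.
by exists u, h1, h, L1, L; split=> //; apply: (subsetP GS).
Qed.

(** The nodes are the classes with a phase; each will have a reservoir of its own. *)
Definition double_cover (T : finType) (c : rel T) : rel (T * bool) :=
  fun x y => c x.1 y.1 && (x.2 != y.2).

Lemma double_cover_sym (T : finType) (c : rel T) :
  symmetric c -> symmetric (double_cover c).
Proof. by move=> sc x y; rewrite /double_cover sc eq_sym. Qed.

Lemma connect_double_cover (T : finType) (c : rel T) x y b :
  connect c x y -> exists b', connect (double_cover c) (x, b) (y, b').
Proof.
case/connectP => p + ->; elim: p x b => [|z p IH] x b /=; first by exists b.
case/andP=> cxz /(IH z (~~ b)) [b' hb']; exists b'.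
by apply: connect_trans (connect1 _) hb'; rewrite /double_cover /= cxz; case: b.
Qed.

(** Each second endpoint gets a phase reachable in the double cover from the lift of [b0], and its
    partner the opposite one. If the component is bipartite only one phase is reachable, so [ph]
    cannot be prescribed. *)
Lemma connected_matching_phase (T : finType) (L : {set T}) (c : rel T)
    (a0 b0 : T) (M : seq (T * T)) :
  symmetric c -> connected_matching L c ((a0, b0) :: M) ->
  exists ph : T -> bool, forall p, p \in (a0, b0) :: M ->
    ph p.1 = ~~ ph p.2 /\
    connect (double_cover (within L c)) (b0, ph b0) (p.2, ph p.2).
Proof.
set M' := _ :: M => sc [mM conM].
have sw : symmetric (within L c).
  by move=> x y; rewrite /within sc; case: (x \in L) (y \in L) => [] [].
have conb p : p \in M' -> connect (within L c) b0 p.2.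
  have edge q : q \in M' -> connect (within L c) q.1 q.2.
    case/andP: mM => _ /allP h /h/and3P[h1 h2 h3].
    by apply: connect1; rewrite /within h1 h2.
  move=> pM; apply: connect_trans (connect_trans (conM (a0, b0) p _ pM) (edge p pM)).
    by rewrite (sym_connect_sym sw); apply: (edge (a0, b0)); rewrite mem_head.
  by rewrite mem_head.
pose rho := double_cover (within L c).
have srho : connect_sym rho by apply: sym_connect_sym; apply: double_cover_sym.
pose pb y := connect rho (b0, true) (y, true).
have pb0 : pb b0 by apply: connect0.
have pbP p : p \in M' -> connect rho (b0, true) (p.2, pb p.2).
  move=> pM; rewrite /pb; case: (boolP (connect rho (b0, true) (p.2, true))) => // h.
  by have [[] hb] := connect_double_cover true (conb p pM); rewrite ?hb // in h *.
have uM : uniq (covered M') by case/andP: mM.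
have [u1 u2 d12] : [/\ uniq (unzip1 M'), uniq (unzip2 M')
    & forall x, x \in unzip2 M' -> x \notin unzip1 M'].
  by move: uM; rewrite cat_uniq => /and3P[-> /hasPn h ->].
exists (fun x => if x \in unzip1 M' then
  ~~ pb (nth x (unzip2 M') (index x (unzip1 M'))) else pb x) => p pM.
have p1M : p.1 \in unzip1 M' by apply: map_f.
have p2M : p.2 \in unzip2 M' by apply: map_f.
have b0M : b0 \in unzip2 M' by rewrite mem_head.
rewrite p1M (negbTE (d12 _ p2M)) (negbTE (d12 _ b0M)) pb0; split; last exact: pbP.
congr (~~ pb _); have iM : index p M' < size M' by rewrite index_mem.
have E1 : p.1 = nth p.1 (unzip1 M') (index p M') by rewrite (nth_map p) // nth_index.
rewrite {2}E1 index_uniq ?size_map // (nth_map p) // nth_index //.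
Qed.

Definition half_piece (V : finType) (e : rel V) (s l : nat) (A B W : {set V})
    (p : seq V) : Prop :=
  [/\ sorted e p, uniq p, size p = l, {subset p <= A :|: B}
    & hits e s (take (2 * s) p) W /\ hits e s (drop (l - 2 * s) p) W].

(** One long path is cut into two pieces. In the first pair of the matching this lets the chain
    begin with one piece and end with the other. *)
Lemma pair_pieces (V : finType) (e : rel V) (phi : V -> bool) (b : bool)
    (A B W : {set V}) (n s l : nat) :
  symmetric e -> joined e s A B -> joined e s A W ->
  (forall x, x \in A -> phi x = b) -> (forall x, x \in B -> phi x = ~~ b) ->
  (forall x, x \in W -> phi x = ~~ b) -> #|A| = n -> #|B| = n ->
  2 * l + 4 * s + 2 <= 2 * n -> 2 * s <= l ->
  exists pp : seq V * seq V, [/\ half_piece (cross e phi) s l A B W pp.1,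
    half_piece (cross e phi) s l A B W pp.2 & uniq (pp.1 ++ pp.2)].
Proof.
move=> se jAB jAW fA fB fW cA cB ln sl.
have jAB' := cross_joined jAB fA fB.
have [||p [sp up szp inp]] := @long_path V (cross e phi) (fun v => phi v == b)
  A B n s (cross_sym _ se) (@cross_bipartite _ _ _ _) _ _ cA cB jAB'.
- by move=> x /fA/eqP.
- by move=> x /fB ->; case: b {fA fB fW}.
have half q : sorted (cross e phi) q -> uniq q -> size q = l -> {subset q <= p} ->
    half_piece (cross e phi) s l A B W q.
  move=> sq uq szq qp; split=> //; first by move=> v /qp/inp.
  split.
    apply: (window_hits jAW _ _ _ _ fA fB fW); rewrite ?take_sorted ?take_uniq //.
      by rewrite size_takel // szq.
    by move=> v /mem_take/qp/inp.
  apply: (window_hits jAW _ _ _ _ fA fB fW); rewrite ?drop_sorted ?drop_uniq //.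
    by rewrite size_drop szq subKn.
  by move=> v /mem_drop/qp/inp.
have l2p : 2 * l <= size p by lia.
exists (take l p, take l (drop l p)); split=> /=.
- apply: half; rewrite ?take_sorted ?take_uniq //; last by move=> v /mem_take.
  by rewrite size_takel //; lia.
- apply: half; rewrite ?take_sorted ?take_uniq ?drop_sorted ?drop_uniq //.
    by rewrite size_takel // size_drop; lia.
  by move=> v /mem_take/mem_drop.
- by rewrite -takeD take_uniq.
Qed.

Lemma seq_choice (T : eqType) (Y : Type) (y0 : Y) (P : T -> Y -> Prop) (r : seq T) :
  (forall x, x \in r -> exists y, P x y) ->
  exists f : T -> Y, forall x, x \in r -> P x (f x).
Proof.
elim: r => [|x r IH] h; first by exists (fun=> y0).
have [f hf] : exists f : T -> Y, forall x, x \in r -> P x (f x).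
  by apply: IH => z zr; apply: h; rewrite inE zr orbT.
have [y hy] := h x (mem_head _ _).
exists (fun z => if z == x then y else f z) => z.
by rewrite inE; case: eqP => [->|_] //=; apply: hf.
Qed.

Lemma uniq_flatten_pairs (V T : eqType) (g : V -> T) (F : T * T -> seq V)
    (M : seq (T * T)) :
  uniq (covered M) -> (forall p, p \in M -> uniq (F p)) ->
  (forall p v, p \in M -> v \in F p -> (g v == p.1) || (g v == p.2)) ->
  uniq (flatten (map F M)).
Proof.
elim: M => [|p M IH] // uM uF gF.
have FM : forall q, q \in M -> q \in p :: M by move=> q qM; rewrite inE qM orbT.
move: uM; rewrite (perm_uniq (perm_covered_cons p M)) !cons_uniq => /and3P[p1 p2 uM].
rewrite /= cat_uniq uF ?mem_head //= IH // ?andbT; last first.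
- by move=> q v /FM; apply: gF.
- by move=> q /FM; apply: uF.
apply/hasPn => v /flattenP[_ /mapP[q qM ->]] vq; apply/negP => vp.
have q1 : q.1 \in covered M by rewrite mem_cat (map_f fst qM).
have q2 : q.2 \in covered M by rewrite mem_cat (map_f snd qM) orbT.
have gc : g v \in covered M.
  by case/orP: (gF q v (FM _ qM) vq) => /eqP->.
have : p.1 \notin covered M by apply: contra p1; rewrite inE orbC => ->.
by case/orP: (gF p v (mem_head _ _) vp) => /eqP E; rewrite -E gc in p2 *.
Qed.

Lemma card_chunk_ge (V : finType) (m : nat) (A : {set V}) (k : nat) : 0 < m ->
  k * m <= #|A| -> #|[set v in A | k <= chunk m A v]| + k * m = #|A|.
Proof.
move=> m0; elim: k => [|k IH] kA.
  by rewrite addn0; apply: eq_card => v; rewrite !inE andbT.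
rewrite mulSn in kA; rewrite -IH ?(leq_trans (leq_addl _ _) kA) // mulSn addnA.
congr (_ + _); rewrite -(cardsID [set v | chunk m A v == k] [set v in A | k <= _]).
rewrite addnC; congr (_ + _); last first.
  apply: eq_card => v; rewrite !inE; case: ltngtP; rewrite ?andbF ?andbT //.
rewrite (_ : _ :&: _ = [set v in A | chunk m A v == k]).
  rewrite card_chunk //; apply/esym/minn_idPl; lia.
by apply/setP => v; rewrite !inE -andbA; case: eqP => [->|_]; rewrite ?leqnn ?andbF.
Qed.

(** The cycle uses a segment of a chain of pieces through the pairs of [M], or of a single piece if
    [t] is small. The pair [(a0, b0)] supplies both ends of the chain and the root with its
    branches. *)
Lemma cycles_of_connected_matching (V T : finType) (e : rel V) (c : rel T)
    (g : V -> T) (L : {set T}) (m s j t : nat) (M : seq (T * T)) :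
  symmetric e -> symmetric c -> (forall a, a \in L -> #|cls g a| = m) ->
  (forall a b, a \in L -> b \in L -> c a b -> joined e s (cls g a) (cls g b)) ->
  connected_matching L c M -> 0 < size M -> 0 < s ->
  4 * #|T| * size M <= 6 * s -> 70 * s + 8 + 4 * #|T| <= m -> #|V| <= 2 ^ j ->
  ~~ odd t -> 2 * j + 6 <= t -> t + 4 <= 2 * size M * (m - 47 * s) ->
  exists cy, [/\ uniq cy, size cy = t & cycle e cy].
Proof.
move=> se sc cL jL; case: M => [|[a0 b0] M] // cM _ s0 TM ms Vj tev tlo thi.
have [r tr] : exists r, t = r + r.
  by exists t./2; rewrite addnn even_halfK.
clear tev.
have [ph hph] := connected_matching_phase sc cM.
have [mM _] := cM; have [uM allM] := andP mM.
pose rho := double_cover (within L c).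
have srho : symmetric rho.
  apply: double_cover_sym => x y; rewrite /within sc.
  by case: (x \in L) (y \in L) => [] [].
pose ck v := chunk (8 * s) (cls g (g v)) v.
(* Roles of the chunks of size [8 * s]: 0 and 1 are the reservoirs of the phases [false] and [true],
   2 and 3 hold the branches, 4 the root; all later ones form [main] and carry the pieces. *)
pose sub a k := [set v in cls g a | chunk (8 * s) (cls g a) v == k].
have s80 : 0 < 8 * s by rewrite muln_gt0.
have subP v a k : v \in sub a k -> g v = a /\ ck v = k.
  by rewrite !inE => /andP[/eqP E /eqP h]; rewrite /ck E.
have card_sub a k : a \in L -> k < 5 -> #|sub a k| = 8 * s.
  move=> aL k5; rewrite card_chunk // cL //; apply/minn_idPl.
  by have := leq_mul k5 (leqnn (8 * s)); rewrite mulSn; move: (k * _) => x; lia.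
pose main a := [set v in cls g a | 4 < chunk (8 * s) (cls g a) v].
have mainP v a : v \in main a -> g v = a /\ 4 < ck v.
  by rewrite !inE => /andP[/eqP E h]; rewrite /ck E.
have sub_cls a k : sub a k \subset cls g a.
  by apply/subsetP => v /subP[<- _]; rewrite inE.
have main_cls a : main a \subset cls g a.
  by apply/subsetP => v /mainP[<- _]; rewrite inE.
have card_main a : a \in L -> #|main a| = m - 40 * s.
  move=> aL; have /(card_chunk_ge s80) : 5 * (8 * s) <= #|cls g a|.
    by rewrite cL //; lia.
  by rewrite cL // => <-; rewrite mulnA addnK.
pose phi v := if ck v == 0 then false else if ck v == 1 then true else ph (g v).
pose W (x : T * bool) := sub x.1 (nat_of_bool x.2).
have phiW v x : v \in W x -> phi v = x.2.
  by case/subP => _; rewrite /phi => ->; case: x.2.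
have phi_big v : 1 < ck v -> phi v = ph (g v).
  by rewrite /phi; case: (ck v) => [|[|k]].
pose e' := cross e phi.
have se' : symmetric e' by apply: cross_sym.
have Wdisj v x y : v \in W x -> v \in W y -> x = y.
  case: x y => [a b] [a' b'] /subP[/= <- ckb] /subP[/= <- ckb'].
  by congr (_, _); move: ckb'; rewrite ckb; case: b b' {ckb} => [] [].
have Wj x y : rho x y -> joined e' s (W x) (W y).
  case/andP => /and3P[xL yL cxy] bxy.
  apply: (@cross_joined _ _ _ x.2).
  - by apply: joined_sub (jL _ _ xL yL cxy); apply: sub_cls.
  - by move=> v; apply: phiW.
  - by move=> v /phiW ->; case: x.2 y.2 bxy => [] [].
(* The five chunks cost [40 * s] vertices per class, and the vertices missed by the long path at
   most [3 * s] per piece, so [l] is [m - 43 * s]. Two windows of [2 * s] lost per appended piece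
   lead to 47. *)
have [l [lE l2 l3 l4]] : exists l, [/\ l - 4 * s = m - 47 * s,
    2 * l + 4 * s + 2 <= 2 * (m - 40 * s), 20 * s + 8 + 4 * #|T| <= l & 2 * s <= l].
  by exists (m - 43 * s); clear -ms s0; split; lia.
have pp p : p \in (a0, b0) :: M -> exists pp : seq V * seq V,
    [/\ half_piece e' s l (main p.1) (main p.2) (W (p.2, ph p.2)) pp.1,
      half_piece e' s l (main p.1) (main p.2) (W (p.2, ph p.2)) pp.2
      & uniq (pp.1 ++ pp.2)].
  move=> pM; have [h1 h2] := hph p pM; have /and3P[p1 p2 cp] := allP allM p pM.
  apply: (@pair_pieces _ _ _ (ph p.1) _ _ _ (m - 40 * s)) => //.
  - by apply: joined_sub (jL _ _ p1 p2 cp); apply: main_cls.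
  - by apply: joined_sub (jL _ _ p1 p2 cp); [apply: main_cls|apply: sub_cls].
  - by move=> v /mainP[<- h]; apply: phi_big; apply: leq_trans h.
  - by move=> v /mainP[E h]; rewrite h1 negbK -E; apply: phi_big; apply: leq_trans h.
  - by move=> v /phiW ->; rewrite h1 negbK.
  - exact: card_main.
  - exact: card_main.
have [f hf] := seq_choice ([::], [::]) pp.
pose F p := (f p).1 ++ (f p).2.
pose node (p : T * T) := (p.2, ph p.2).
have gF p v : p \in (a0, b0) :: M -> v \in F p -> v \in main p.1 :|: main p.2.
  move=> /hf[[_ _ _ h1 _] [_ _ _ h2 _] _].
  by rewrite mem_cat => /orP[/h1|/h2].
have uF p : p \in (a0, b0) :: M -> uniq (F p) by case/hf.
have uFM : uniq (flatten (map F ((a0, b0) :: M))).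
  apply: (@uniq_flatten_pairs _ _ g) => // p v pM /(gF p v pM).
  by rewrite inE => /orP[] /mainP[-> _]; rewrite eqxx ?orbT.
(* Both pieces of every pair except [(a0, b0)], whose first piece starts the chain and whose second
   one ends it. *)
pose ps := flatten [seq [:: ((f p).1, node p); ((f p).2, node p)] | p <- M].
have ps_flat : flatten (unzip1 ps) = flatten (map F M).
  by rewrite /ps; elim: (M) => //= p M' ->; rewrite catA.
have size_ps : size ps = 2 * size M.
  by rewrite /ps; elim: (M) => //= p M' ->; rewrite mulnS.
pose ok v := (ck v < 2) || (4 < ck v).
have okW v x : v \in W x -> ok v by case/subP => _; rewrite /ok => ->; case: x.2.
have ok_main v a : v \in main a -> ok v by case/mainP => _; rewrite /ok => ->; rewrite orbT.
have main_W v a x : v \in main a -> v \notin W x.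
  case/mainP => _ h; apply/negP => /subP[_ E]; move: h; rewrite E.
  by case: x.2.
have half_pieceP p q : p \in (a0, b0) :: M ->
    half_piece e' s l (main p.1) (main p.2) (W (p.2, ph p.2)) q ->
    piece e' rho W s (2 * s) l ok (b0, ph b0) (q, node p).
  move=> pM [sq uq szq qm [hq1 hq2]]; have [_ con] := hph p pM.
  split=> //; split=> //= v; [|move=> x].
    by move/qm; rewrite inE => /orP[]; apply: ok_main.
  by move/qm; rewrite inE => /orP[]; apply: main_W.
have p0M : (a0, b0) \in (a0, b0) :: M by apply: mem_head.
have [hQ hlast uQl] := hf _ p0M.
have [ph0 _] := hph _ p0M; rewrite /= in ph0.
have /and3P[/= a0L b0L cab] := allP allM _ p0M.
have Lrho x : connect rho (b0, ph b0) x -> x.1 \in L.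
  case/connectP => q + ->; have : (b0, ph b0).1 \in L by [].
  elim: q (b0, ph b0) => //= z q IH y yL.
  by case/andP => /andP[/and3P[_ zL _] _]; apply: IH.
pose A := [set v in cls g a0 | 1 < ck v].
pose B := [set v in cls g b0 | 1 < ck v].
have phA v : v \in A -> phi v = ph a0.
  by rewrite !inE => /andP[/eqP <-]; apply: phi_big.
have phB v : v \in B -> phi v = ~~ ph a0.
  by rewrite !inE ph0 negbK => /andP[/eqP <-]; apply: phi_big.
have jAB : joined e' s A B.
  apply: (@cross_joined _ _ _ (ph a0)) => //.
  apply: joined_sub (jL _ _ a0L b0L cab); apply/subsetP => v;
  by rewrite inE => /andP[].
have subA k : 1 < k -> sub a0 k \subset A.
  by move=> k1; apply/subsetP => v /subP[E kv]; rewrite !inE E eqxx kv.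
have subB k : 1 < k -> sub b0 k \subset B.
  by move=> k1; apply/subsetP => v /subP[E kv]; rewrite !inE E eqxx kv.
have mainAB v : v \in main a0 :|: main b0 -> v \in A :|: B.
  rewrite !in_setU => /orP[] /mainP[E kv]; apply/orP; [left|right];
  by rewrite !inE E eqxx (leq_trans _ kv).
have ab0 : a0 != b0.
  move: uM; rewrite (perm_uniq (perm_covered_cons _ _)) cons_uniq => /andP[+ _].
  by apply: contraNneq => /= ->; apply: mem_head.
have dis a b k k' : (a, k) != (b, k') -> [disjoint sub a k & sub b k'].
  move=> ne; rewrite -setI_eq0; apply/eqP/setP => v; rewrite !inE.
  apply/negP => /andP[/andP[/eqP E1 /eqP E2] /andP[/eqP E3 /eqP E4]].
  by case/eqP: ne; rewrite -E1 -E2 -E3 -E4 -E1 E3.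
have disS k : k != 4 -> [disjoint sub a0 4 & sub a0 k :|: sub b0 k].
  move=> k4; rewrite -setI_eq0 setIUr setU_eq0 !setI_eq0 !dis //;
  by rewrite xpair_eqE negb_and (eq_sym 4) k4 orbT.
have disab k : [disjoint sub a0 k & sub b0 k].
  by apply: dis; rewrite xpair_eqE negb_and ab0.
have big8 a k : a \in L -> k < 5 -> 8 * s <= #|sub a k|.
  by move=> aL k5; rewrite card_sub.
have jj k k' : 1 < k -> 1 < k' -> joined e' s (sub a0 k) (sub b0 k').
  by move=> k1 k1'; apply: joined_sub jAB; [apply: subA|apply: subB].
have sS : 2 * s <= #|sub a0 4| by rewrite card_sub // leq_mul.
have [u [h1 [h2 [L1 [L2 [uS hj1 hj2 br1 br2]]]]]] :=
  two_branchings se' s0 (disab 2) (disS 2 isT) (disab 3) (disS 3 isT)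
    (big8 a0 2 a0L isT) (big8 b0 2 b0L isT) (big8 a0 3 a0L isT) (big8 b0 3 b0L isT)
    (jj 4 2 isT isT) (jj 2 2 isT isT) (jj 4 3 isT isT) (jj 3 3 isT isT) sS Vj.
have h1_gt0 h X Y L' : [disjoint sub a0 4 & X :|: Y] -> branching e' s h X Y L' u -> 0 < h.
  move=> dXY [sL LXY hL]; have /card_gt0P[x xL] : 0 < #|L'| by apply: leq_trans sL.
  have [q [_ lq <- _ _]] := hL x xL; case: q lq => //= ux.
  have : x \in X :|: Y.
    by rewrite inE; case: LXY => /subsetP/(_ x xL)->; rewrite ?orbT.
  by rewrite -ux (disjointFr dXY uS).
have h1p := h1_gt0 _ _ _ _ (disS 2 isT) br1.
have h2p := h1_gt0 _ _ _ _ (disS 3 isT) br2.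
(* [t'] is the number of edges of the segment. As [h1] and [h2] are at most [j + 2], the bound
   [2 * j + 6 <= t] makes the subtraction exact. *)
have [t' tE] : exists t', t = t' + h1 + h2 + 2.
  by exists (t - h1 - h2 - 2); clear -tlo hj1 hj2; lia.
have par : ~~ odd (t' + h1 + h2).
  by have := congr1 odd tr; rewrite tE addnn odd_double addn2 /= negbK => ->.
have okQ (Q : seq V) : (forall v, v \in Q -> ok v) -> forall v, v \in Q ->
    [&& v != u, v \notin sub a0 2 :|: sub b0 2 & v \notin sub a0 3 :|: sub b0 3].
  move=> Qok v /Qok okv; have [_ ck4] := subP _ _ _ uS.
  apply/and3P; split.
  - by apply: contraTneq okv => ->; rewrite /ok ck4.
  - by rewrite inE; apply: contraTN okv => /orP[] /subP[_ E]; rewrite /ok E.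
  - by rewrite inE; apply: contraTN okv => /orP[] /subP[_ E]; rewrite /ok E.
have dX : [disjoint sub a0 2 :|: sub b0 2 & sub a0 3 :|: sub b0 3].
  rewrite -setI_eq0 setIUr !setIUl !setU_eq0 !setI_eq0 !dis //;
  by rewrite xpair_eqE andbF.
have uA : u \in A by apply: (subsetP (subA 4 isT)).
have subAA : sub a0 2 :|: sub a0 3 \subset A by rewrite subUset !subA.
have subBB : sub b0 2 :|: sub b0 3 \subset B by rewrite subUset !subB.
have close (Q : seq V) w : sorted e' Q -> uniq Q -> (forall v, v \in Q -> ok v) ->
    (forall v, v \in take w Q -> v \in A :|: B) ->
    (forall v, v \in drop (size Q - w) Q -> v \in A :|: B) ->
    4 * s + 4 <= w -> w <= size Q -> t' + 4 * s + 4 <= size Q ->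
    size Q + 4 * s + 4 <= t' + 2 * w ->
    exists cy, [/\ uniq cy, size cy = t & cycle e cy].
  move=> sQ uQ Qok Qw Qw' sw wQ tQ tQ'.
  have [||cy [ucy scy cycy]] := @close_cycle _ e' (fun v => phi v == ph a0) s w t' h1 h2 A B
    (sub a0 2) (sub b0 2) (sub a0 3) (sub b0 3) L1 L2 u Q se'
    (@cross_bipartite _ _ _ _) _ _ jAB uA subAA subBB s0 br1 br2 dX (okQ Q Qok)
    sQ uQ Qw Qw' sw wQ tQ tQ' par.
  - by move=> v /phA ->; rewrite eqxx.
  - by move=> v /phB ->; case: (ph a0).
  exists cy; split=> //; first by rewrite scy tE.
  by apply: sub_cycle cycy => x y /andP[].
case: hQ => sQ uQ szQ QAB [hQ1 hQ2].
have Qok v : v \in (f (a0, b0)).1 -> ok v.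
  by move=> /QAB; rewrite inE => /orP[]; apply: ok_main.
(* A short segment fits into the first piece, which then serves entirely as both windows. *)
case: (leqP (t' + 4 * s + 4) l) => t'l.
  apply: (close _ l sQ uQ Qok); rewrite ?szQ //.
  - by move=> v /mem_take/QAB/mainAB.
  - by move=> v /mem_drop/QAB/mainAB.
  - by clear -l3; lia.
  - by clear -l3 s0; lia.
have card_node : #|{: T * bool}| = 2 * #|T| by rewrite card_prod card_bool mulnC.
have MM : 2 * #|T| * (size ps).+1 <= 6 * s.
  rewrite size_ps; apply: leq_trans TM; rewrite [size (_ :: _)]/=.
  by clear; move: #|T| (size M) => x y; nia.
have c_big : 2 * #|{: T * bool}| + 4 * (2 * s) + 8 * s + 8 <= l.
  by rewrite card_node; clear -l3; lia.
have c_last : piece e' rho W s (2 * s) l ok (b0, ph b0) ((f (a0, b0)).2, node (a0, b0)).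
  exact: half_pieceP p0M hlast.
have c_ps py : py \in ps -> piece e' rho W s (2 * s) l ok (b0, ph b0) py.
  case/flattenP => _ /mapP[p pM ->].
  have pM0 : p \in (a0, b0) :: M by rewrite inE pM orbT.
  have [hp1 hp2 _] := hf p pM0.
  by rewrite !inE => /orP[] /eqP ->; apply: half_pieceP.
have uFM' : uniq ((f (a0, b0)).1 ++ (f (a0, b0)).2 ++ flatten (map F M)).
  by move: uFM; rewrite /= -catA.
have c_uniq : uniq (flatten (unzip1 ps) ++ (f (a0, b0)).2).
  by move: uFM'; rewrite cat_uniq uniq_catC ps_flat => /and3P[].
have c_disj v : v \in (f (a0, b0)).1 -> v \notin flatten (unzip1 ps) ++ (f (a0, b0)).2.
  move=> vQ; move: uFM'; rewrite cat_uniq => /and3P[_ /hasPn h _].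
  by rewrite ps_flat mem_cat orbC -mem_cat; apply: contraL vQ => /h.
have c_hits : hits e' s (drop (size (f (a0, b0)).1 - 2 * s) (f (a0, b0)).1) (W (b0, ph b0)).
  by rewrite szQ.
have c_avail x : connect rho (b0, ph b0) x ->
    2 * s + #|{: T * bool}| * (size ps).+1 <= #|W x :\: [set v in (f (a0, b0)).1]|.
  move=> /Lrho xL; have -> : W x :\: [set v in (f (a0, b0)).1] = W x.
    apply/setP => v; rewrite in_setD inE; case: (boolP (v \in (f (a0, b0)).1)) => //= /QAB.
    by rewrite in_setU => vm; apply/esym/negbTE; case/orP: vm; apply: main_W.
  rewrite card_sub //; last by case: x.2.
  by rewrite card_node; move: MM; clear; lia.
have c_lo : size (f (a0, b0)).1 + #|{: T * bool}| + (2 * (2 * s) + 4 * s + 4) <= t' + l.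
  by rewrite szQ card_node; clear -l3 t'l; lia.
have c_hi : t' + (2 * (2 * s) + 4 * s + 4) <=
    size (f (a0, b0)).1 + size ps * (l - 2 * (2 * s)) + l.
  rewrite szQ size_ps; move: thi; rewrite -lE tE [size (_ :: _)]/= mulnS mulnDl.
  rewrite mulnA; move: (2 * size M * (l - 4 * s)) => x thi.
  by clear -thi l3 h1p h2p; lia.
have [Q' [sQ' uQ' tQ' dQ' [n1 n2 Q'ok]]] := chain_grow se' srho Wdisj Wj okW
  c_big c_last c_ps c_uniq c_disj sQ uQ (eq_leq (esym szQ)) Qok (connect0 _ _)
  c_hits c_avail c_lo c_hi.
apply: (close Q' (l - 2 * s) sQ' uQ' Q'ok).
- by rewrite tQ' => v /mem_take/QAB/mainAB.
- rewrite dQ' => v /mem_drop; case: hlast => _ _ _ hm _.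
  by move/hm/mainAB.
- by clear -l3; lia.
- by have := congr1 size tQ'; rewrite !size_take_min szQ; clear; lia.
- by clear -n1; lia.
- by clear -n2 l3; lia.
Qed.

(** * Two-colored graphs without large empty pairs *)

(** In units of [1/Q] the relative losses are 30 from the matching, 47 from the [47 * s] vertices
    per class and 1 from the leftover, 78 in all. As [Q] is [4 * 78 * q], they cost [n / 2] out of
    [2 * q * n]; another [n / 2] covers [12 * q]. *)
Lemma two_thirds_arith (n k m s q M : nat) : 0 < q ->
  let Q := 312 * q in
  Q * n <= Q * (k * m) + n -> Q * s <= m -> Q * k <= 3 * Q * M + 10 * k + 10 * Q ->
  Q * m <= n -> 24 * q <= n ->
  (2 * q - 1) * n + 12 * q <= 6 * q * M * (m - 47 * s).
Proof.
move=> q0 Q; have QE : Q = 312 * q by []; clearbody Q.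
have Q312 : 312 <= Q by lia.
move=> h1 h2 h3 h4 h5; set x := m - 47 * s.
have n0 : 0 < n by lia.
(* This turns the additive [10 * Q] into at most [20 * k], which with [10 * k] makes 30. *)
have kQ : Q - 1 <= k.
  have : (Q - 1) * n <= k * n by rewrite mulnBl; nia.
  by rewrite leq_pmul2r.
have h3' : (Q - 30) * k <= 3 * Q * M by rewrite mulnBl; lia.
have h2' : (Q - 47) * m <= Q * x by rewrite /x mulnBl mulnBr; lia.
have e1 : (Q - 30) * (Q - 47) * (k * m) <= 3 * Q * Q * (M * x).
  by have := leq_mul h3' h2'; rewrite !mulnA; lia.
have e2 : (Q - 1) * n <= Q * (k * m) by rewrite mulnBl; lia.
have e3 : Q - 77 <= Q by lia.
have e4 : Q * (Q - 77) <= (Q - 30) * (Q - 47) by nia.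
have e5 : (Q - 77) * (k * m) <= 3 * Q * (M * x).
  have : Q * ((Q - 77) * (k * m)) <= Q * (3 * Q * (M * x)).
    apply: (@leq_trans ((Q - 30) * (Q - 47) * (k * m))).
      by rewrite mulnA leq_mul2r e4 orbT.
    by apply: leq_trans e1 _; rewrite !mulnA (mulnC Q 3).
  by rewrite leq_pmul2l //; lia.
have e6 : Q * (Q - 78) <= (Q - 77) * (Q - 1) by nia.
have e7 : (Q - 78) * n <= 3 * Q * (M * x).
  have : Q * ((Q - 78) * n) <= Q * (3 * Q * (M * x)).
    apply: (@leq_trans ((Q - 77) * (Q - 1) * n)).
      by rewrite mulnA leq_mul2r e6 orbT.
    rewrite -mulnA; apply: leq_trans (leq_mul (leqnn (Q - 77)) e2) _.
    by rewrite mulnCA leq_mul2l e5 orbT.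
  by rewrite leq_pmul2l //; lia.
have nN : n <= q * n by rewrite leq_pmull.
move: e7 nN; rewrite QE !mulnBl mul1n -!mulnA; clear -h5.
by move: (M * x) => y; move: (q * n) (q * y) => N Z; lia.
Qed.

(** The deterministic core, for lengths up to [2/3 - 1/(3q)] times the number of vertices. Only the
    red graph [r] is partitioned: in a pair without red edges the density hypothesis provides blue
    ones, so this pair is joined in blue. *)
Lemma even_cycles_two_colors (q : nat) : 0 < q ->
  exists G n0 : nat, 0 < G /\ forall (V : finType) (r b : rel V) (j : nat),
    symmetric r -> symmetric b -> n0 <= #|V| -> #|V| <= 2 ^ j ->
    (forall X Y : {set V}, [disjoint X & Y] -> #|V| <= G * #|X| ->
       #|V| <= G * #|Y| -> exists x y, [/\ x \in X, y \in Y & r x y || b x y]) ->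
    exists2 e : rel V, e = r \/ e = b &
      forall t, ~~ odd t -> 2 * j + 6 <= t -> 3 * q * t <= (2 * q - 1) * #|V| ->
        exists cy, [/\ uniq cy, size cy = t & cycle e cy].
Proof.
move=> q0; have [Q QE] : exists Q, Q = 312 * q by exists (312 * q).
have Q1 : 1 < Q by lia.
have Q0 : 0 < Q by apply: ltnW.
have [K K0 hK] := clustering_exists Q1 Q0.
(* Since [#|V| <= 2 * Q * K * s], sets of [s] vertices are large enough for this [G]. The summands
   of [n0] serve in turn the clustering, the bound [K * K <= s], the condition [24 * q <= #|V|] and
   a lower bound on [m]. *)
exists (2 * Q * K), (K + 2 * Q * K * (K * K) + 24 * q + K * (64 + 32 * K)).
split; first by rewrite !muln_gt0 Q0 K0.
move=> V r b j sr sb nV Vj large.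
have [|T [g [L [m [TK Vm Dm QmV [clsL hleft hbad]]]]]] := hK V r; first by lia.
set s := m %/ Q in hbad.
have Qs : Q * s <= m by rewrite mulnC leq_trunc_div.
have ms : m <= 2 * Q * s.
  have := ltn_ceil m Q0; rewrite -/s; have : 0 < s by rewrite divn_gt0.
  by nia.
have VG : #|V| <= 2 * Q * K * s by nia.
have s0 : 0 < s by rewrite divn_gt0.
pose bad a c := ~~ pure r g a c && ~~ joined r s (cls g a) (cls g c).
(* Labels that are bad with more than a [1/Q] fraction of [L] are dropped; by averaging they are at
   most a [1/Q] fraction themselves. *)
pose L' := [set a in L | Q * #|[set c in L | bad a c]| <= #|L|].
have L'L : L' \subset L by apply/subsetP => a; rewrite inE => /andP[].
have V0 : 0 < #|V| by lia.
have cL : #|V| <= #|L| * m + #|[set v | g v \notin L]| by apply: card_cls_cover.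
have cL' : Q * #|L :\: L'| <= #|L|.
  case: (posnP #|L|) => L0.
    have -> : #|L :\: L'| = 0; last by rewrite muln0.
    by apply/eqP; rewrite -leqn0 -L0 subset_leq_card // subsetDl.
  set Bad := [set p | _] in hbad.
  have sumBad : \sum_(a in L :\: L') #|[set c in L | bad a c]| <= #|Bad|.
    rewrite -[#|Bad|]sum1_card.
    rewrite (bigID (fun p : T * T => p.1 \in L :\: L')) /=.
    apply: leq_trans (leq_addr _ _).
    rewrite (partition_big fst (mem (L :\: L'))) /=; last by move=> p /andP[].
    apply: leq_sum => a; rewrite inE => /andP[aL' aL].
    rewrite sum1_card -(card_imset _ (f := pair a)); last by move=> x y [].
    apply: subset_leq_card; apply/subsetP => _ /imsetP[c + ->].
    rewrite inE => /andP[cLL bac]; rewrite unfold_in /= !inE /= eqxx andbT.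
    move: aL'; rewrite inE aL /= => ->.
    by rewrite cLL -/(bad a c) bac.
  have : #|L :\: L'| * #|L| <= Q * #|Bad|.
    apply: leq_trans (leq_mul (leqnn Q) sumBad); rewrite big_distrr /= -sum_nat_const.
    apply: leq_sum => a; rewrite inE => /andP[+ aL].
    by rewrite inE aL -ltnNge => /ltnW.
  move/(leq_mul (leqnn Q)); rewrite !mulnA mulnn => h.
  by have := leq_trans h hbad; rewrite -mulnn leq_pmul2r.
have sc (e : rel V) : symmetric e ->
    symmetric (fun a c => (a != c) && joined e s (cls g a) (cls g c)).
  move=> se a c; rewrite eq_sym; congr (_ && _).
  by apply/idP/idP; apply: joined_sym.
have [M hM cM] : exists2 M, connected_matching L'
    (fun a c => (a != c) && joined r s (cls g a) (cls g c)) M \/ connected_matching L'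
    (fun a c => (a != c) && joined b s (cls g a) (cls g c)) M
    & #|L'| <= 3 * size M + 9 * (#|L| %/ Q) + 10.
  apply: connected_matching_exists; [exact: sc|exact: sc|].
  move=> a; rewrite inE => /andP[aL ha].
  rewrite leq_divRL // mulnC; apply: leq_trans ha; rewrite leq_mul2l; apply/orP; right.
  apply: subset_leq_card; apply/subsetP => c.
  rewrite 2!inE => /andP[/(subsetP L'L) cL1 /and3P[ca]].
  rewrite (eq_sym a c) ca /= => nr nb; rewrite cL1 /bad nr andbT /=.
  apply: contra nb => /pureP pu; apply/joinedP => X Y Xa Yc sX sY.
  have [|||x [y [xX yY]]] := large X Y.
  - rewrite -setI_eq0; apply/eqP/setP => v; rewrite !inE; apply/negP => /andP[vX vY].
    move: (subsetP Xa v vX) (subsetP Yc v vY); rewrite !inE => /eqP -> ac.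
    by rewrite eq_sym ac in ca.
  - by apply: leq_trans VG _; rewrite leq_mul.
  - by apply: leq_trans VG _; rewrite leq_mul.
  move: (subsetP Xa x xX) (subsetP Yc y yY); rewrite !inE => /eqP gx /eqP gy.
  by rewrite (negbTE (pu x y gx gy)) /=; exists x, y.
have cLD : #|L| = #|L'| + #|L :\: L'| by rewrite -(cardsID L' L) (setIidPr L'L).
have Qd : Q * (#|L| %/ Q) <= #|L| by rewrite mulnC leq_trunc_div.
have arith : (2 * q - 1) * #|V| + 12 * q <= 6 * q * size M * (m - 47 * s).
  apply: (@two_thirds_arith _ #|L|) => //.
  - rewrite -QE; apply: leq_trans (leq_mul (leqnn Q) cL) _.
    by rewrite mulnDr leq_add2l.
  - by rewrite -QE.
  - rewrite -QE [X in Q * X <= _]cLD mulnDr.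
    have := leq_mul (leqnn Q) cM.
    rewrite 2!mulnDr (mulnCA Q 3) (mulnCA Q 9) (mulnC Q 10) -(mulnA 3).
    by move: (Q * size M) (Q * #|L'|) Qd cL'; clear => x y; lia.
  - by rewrite -QE.
  - by clear -nV; lia.
have M0 : 0 < size M.
  rewrite lt0n; apply: contraTneq arith => ->.
  by rewrite muln0 mul0n -ltnNge addn_gt0 orbC muln_gt0 q0.
have main (e : rel V) : symmetric e -> connected_matching L'
    (fun a c => (a != c) && joined e s (cls g a) (cls g c)) M ->
    forall t, ~~ odd t -> 2 * j + 6 <= t -> 3 * q * t <= (2 * q - 1) * #|V| ->
    exists cy, [/\ uniq cy, size cy = t & cycle e cy].
  move=> se cMe t tev tlo thi.
  have MT : size M <= #|T|.
    case: cMe => /andP[+ _] _; rewrite cat_uniq => /and3P[/card_uniqP h _ _].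
    by have := max_card (mem (unzip1 M)); rewrite h size_map.
  apply: (cycles_of_connected_matching (L := L') (M := M) (g := g) (m := m) (s := s)
    (j := j) se (sc e se)) => //.
  - by move=> a /(subsetP L'L)/clsL.
  - by move=> a c _ _ /andP[].
  - have sK : K * K <= s.
      have : 2 * Q * K * (K * K) <= 2 * Q * K * s.
        by apply: leq_trans VG; clear -nV; lia.
      by rewrite leq_pmul2l // !muln_gt0 Q0 K0.
    apply: (@leq_trans (6 * (K * K))); rewrite ?leq_mul2l // -mulnA.
    by rewrite leq_mul // leq_mul // (leq_trans MT).
  - have mK : 64 + 32 * K <= m.
      have : K * (64 + 32 * K) <= K * m by apply: leq_trans Vm; clear -nV; lia.
      by rewrite leq_pmul2l.
    have s312 : 312 * s <= m.
      by apply: leq_trans Qs; rewrite QE leq_mul // leq_pmulr.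
    by clear -mK s312 TK; lia.
  - have : 3 * q * (t + 4) <= 3 * q * (2 * size M * (m - 47 * s)).
      apply: (@leq_trans ((2 * q - 1) * #|V| + 12 * q)).
        by rewrite mulnDr; clear -thi; lia.
      apply: leq_trans arith _; rewrite !mulnA.
      by rewrite leq_mul // leq_mul //; clear; lia.
    by rewrite leq_pmul2l // muln_gt0.
by case: hM => /main h; [exists r; [left|exact: h]|exists b; [right|exact: h]].
Qed.

(** * The random graph *)

From mathcomp Require Import all_order all_algebra.
From mathcomp Require Import all_classical all_reals all_analysis.
From mathcomp Require Import ring lra.

Import Order.TTheory GRing.Theory Num.Theory.
Import numFieldNormedType.Exports.

Local Open Scope ring_scope.

(** The probability that a random subset of [A] avoids [F]. Giving chosen elements outside [A :\: F]
    the factor 0 makes all other terms of the distributed product vanish. *)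
Lemma sum_weight_avoid (R : comNzRingType) (I : finType) (A F : {set I}) (p : R) :
  F \subset A ->
  \sum_(E : {set I} | (E \subset A) && [disjoint E & F])
    \prod_(e in A) (if e \in E then p else 1 - p) = (1 - p) ^+ #|F|.
Proof.
move=> FA.
pose a i : R := if i \in A :\: F then p else 0.
pose b i : R := if i \in A then 1 - p else 1.
have <- : \prod_i (a i + b i) = (1 - p) ^+ #|F|.
  rewrite -prodr_const [RHS]big_mkcond; apply: eq_bigr => i _.
  rewrite /a /b inE; case: (boolP (i \in F)) => [/(fintype.subsetP FA)->|_] /=.
    by rewrite add0r.
  by case: (i \in A); rewrite ?add0r // addrC subrK.
rewrite bigA_distr [RHS](bigID (fun E : {set I} => (E \subset A) && [disjoint E & F])) /=.
rewrite [X in _ = _ + X]big1 ?addr0 => [|E].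
  apply: eq_bigr => E /andP[EA EF]; rewrite big_mkcond; apply: eq_bigr => i _.
  rewrite /a /b inE; case: (boolP (i \in E)) => iE; last by [].
  by rewrite (fintype.subsetP EA) // (disjointFr EF iE).
rewrite -finset.subsetD => /fintype.subsetPn[i iE iAF].
by rewrite (bigD1 i) //= iE /a (negbTE iAF) mul0r.
Qed.

Definition pairs_between (V : finType) (X Y : {set V}) : {set {set V}} :=
  [set [set xy.1; xy.2] | xy in finset.setX X Y].

Lemma card_pairs_between (V : finType) (X Y : {set V}) : [disjoint X & Y] ->
  #|pairs_between X Y| = (#|X| * #|Y|)%N.
Proof.
move=> dXY; rewrite card_in_imset ?cardsX // => -[x y] [x' y'].
move=> /finset.setXP[/= xX yY] /finset.setXP[/= x'X y'Y] E.
have : x \in [set x'; y'] by rewrite -E !inE eqxx.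
rewrite !inE => /orP[/eqP Ex|/eqP Ex]; last first.
  by rewrite -Ex in y'Y; rewrite (disjointFr dXY xX) in y'Y.
have : y \in [set x'; y'] by rewrite -E !inE eqxx orbT.
rewrite !inE => /orP[/eqP Ey|/eqP->]; last by rewrite Ex.
by rewrite -Ey in x'X; rewrite (disjointFr dXY x'X) in yY.
Qed.

Lemma pairs_between_sub (V : finType) (X Y : {set V}) : [disjoint X & Y] ->
  pairs_between X Y \subset pairs V.
Proof.
move=> dXY; apply/fintype.subsetP => _ /imsetP[[x y] /finset.setXP[/= xX yY] ->].
rewrite inE cards2; suff -> : x != y by [].
by apply: contraTneq xX => ->; rewrite (disjointFl dXY yY).
Qed.

Definition dense_edges (G n : nat) (E : {set {set 'I_n}}) : Prop :=
  forall X Y : {set 'I_n}, [disjoint X & Y] -> (n <= G * #|X|)%N ->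
    (n <= G * #|Y|)%N -> exists x y, [/\ x \in X, y \in Y & [set x; y] \in E].

Lemma gnp_weight_ge0 (R : realType) n (p : R) E : 0 <= p <= 1 -> 0 <= @gnp_weight R n p E.
Proof.
by move=> /andP[p0 p1]; apply: prodr_ge0 => e _; case: ifP; rewrite // subr_ge0.
Qed.

Lemma sum_gnp_weight (R : realType) n (p : R) :
  \sum_(E : {set {set 'I_n}} | E \subset pairs 'I_n) gnp_weight p E = 1.
Proof.
have := @sum_weight_avoid R {set 'I_n} (pairs 'I_n) finset.set0 p (finset.sub0set _).
rewrite cards0 expr0 => <-; apply: eq_bigl => E.
by rewrite -finset.setI_eq0 finset.setI0 eqxx andbT.
Qed.

Lemma gnp_prob_le1 (R : realType) n (p : R) Q : 0 <= p <= 1 -> gnp_prob n p Q <= 1.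
Proof.
move=> p01; rewrite -(sum_gnp_weight n p) /gnp_prob [leLHS]big_mkcondr /=.
by apply: ler_sum => E _; case: ifP => // _; apply: gnp_weight_ge0.
Qed.

(** Union bound over at most [4 ^ n] pairs [(X, Y)], each of which spans no edge with probability
    [(1 - p) ^+ (#|X| * #|Y|)]. Both sets have at least [n / G] vertices, so this is at most
    [expR (- 7) ^+ n]. *)
Lemma gnp_prob_ge (R : realType) (G n : nat) (p : R) (Q : graph -> Prop) :
  (0 < G)%N -> 0 <= p <= 1 -> 7 * G%:R ^+ 2 <= n%:R * p ->
  (forall E : {set {set 'I_n}}, E \subset pairs 'I_n -> dense_edges G E -> Q (graph_of_pairs E)) ->
  1 - 2^-1 ^+ n <= gnp_prob n p Q.
Proof.
move=> G0 p01 np hQ; have /andP[p0 p1] := p01.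
pose large (XY : {set 'I_n} * {set 'I_n}) :=
  [&& [disjoint XY.1 & XY.2], (n <= G * #|XY.1|)%N & (n <= G * #|XY.2|)%N].
pose avoid (E : {set {set 'I_n}}) XY := [disjoint E & pairs_between XY.1 XY.2].
have bad (E : {set {set 'I_n}}) : E \subset pairs 'I_n -> ~~ `[< Q (graph_of_pairs E) >] ->
    exists XY, large XY && avoid E XY.
  move=> Ep /asboolPn nQ; apply/existsP; rewrite -[X in is_true X]negbK negb_exists.
  apply/negP => /forallP no.
  apply: nQ; apply: hQ => // X Y dXY nX nY.
  have := no (X, Y); rewrite /large /avoid /= dXY nX nY /= -finset.setI_eq0 => /finset.set0Pn[e].
  by rewrite inE => /andP[eE /imsetP[[x y] /finset.setXP[/= xX yY] Ee]];
    exists x, y; rewrite -Ee.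
rewrite lerBlDr -[leLHS](sum_gnp_weight n p) /gnp_prob.
rewrite (bigID (fun E => `[< Q (graph_of_pairs E) >])) /= lerD2l.
have step : \sum_(E : {set {set 'I_n}} | (E \subset pairs 'I_n) &&
    ~~ `[< Q (graph_of_pairs E) >]) gnp_weight p E <=
  \sum_(XY | large XY) \sum_(E : {set {set 'I_n}} | (E \subset pairs 'I_n) && avoid E XY)
    gnp_weight p E.
  rewrite (exchange_big_dep (fun E : {set {set 'I_n}} => E \subset pairs 'I_n)) /=; last first.
    by move=> XY E _ /andP[].
  rewrite [leLHS]big_mkcondr /=; apply: ler_sum => E Ep; case: ifPn => [nQ|_].
    have [XY /andP[h1 h2]] := bad E Ep nQ.
    rewrite (bigD1 XY) /= ?h1 ?Ep ?h2 // lerDl; apply: sumr_ge0 => *.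
    exact: gnp_weight_ge0.
  by apply: sumr_ge0 => *; apply: gnp_weight_ge0.
apply: le_trans step _.
have one XY : large XY ->
    \sum_(E : {set {set 'I_n}} | (E \subset pairs 'I_n) && avoid E XY) gnp_weight p E
    <= 8^-1 ^+ n.
  case: XY => X Y /and3P[/= dXY nX nY].
  rewrite (sum_weight_avoid p (pairs_between_sub dXY)) card_pairs_between //.
  have e1 : 1 - p <= expR (- p) by apply: expR_ge1Dx.
  apply: le_trans (_ : expR (- p) ^+ (#|X| * #|Y|) <= _).
    by rewrite lerXn2r ?nnegrE ?subr_ge0 // expR_ge0.
  rewrite -expRM_natl.
  (* The constant 7 comes from [1 + 7 <= expR 7]; a factor 8 per vertex beats the [4 ^ n] pairs. *)
  have e7 : expR (- 7) <= 8^-1 :> R.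
    rewrite expRN lef_pV2 ?posrE ?expR_gt0 //.
    by apply: le_trans (expR_ge1Dx 7); rewrite -natr1E.
  apply: le_trans (_ : expR (n%:R * - 7) <= _).
    rewrite ler_expR !mulrN lerN2.
    have G20 : 0 < G%:R ^+ 2 :> R by rewrite exprn_gt0 // ltr0n.
    rewrite -(ler_pM2l G20).
    have : n%:R * n%:R <= G%:R ^+ 2 * (#|X| * #|Y|)%:R :> R.
      by rewrite -natrX -!natrM ler_nat -mulnn mulnACA leq_mul.
    move=> /(ler_wpM2r p0); rewrite -!mulrA => h; apply: le_trans _ h.
    apply: le_trans (ler_wpM2l (ler0n R n) np).
    by rewrite le_eqVlt; apply/orP; left; apply/eqP; ring.
  by rewrite expRM_natl lerXn2r ?nnegrE ?expR_ge0 // invr_ge0.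
apply: le_trans (ler_sum _ one) _.
rewrite sumr_const.
have c4 : (#|large| <= 4 ^ n)%N.
  apply: leq_trans (max_card _) _.
  have cs : #|{: {set 'I_n}}| = (2 ^ n)%N.
    by rewrite -cardsT -finset.powersetT card_powerset cardsT card_ord.
  by rewrite card_prod cs -expnMn.
rewrite -[leLHS]mulr_natr; apply: le_trans (_ : 8^-1 ^+ n * (4 ^ n)%:R <= _).
  by rewrite ler_wpM2l ?exprn_ge0 ?invr_ge0 // ler_nat.
have e84 : 8^-1 * 4 = 2^-1 :> R by field.
by rewrite natrX -exprMn e84 lexx.
Qed.

Lemma whp_of_dense_edges (R : realType) (G : nat) (p : nat -> R)
    (Q : nat -> graph -> Prop) :
  (0 < G)%N -> (forall n, 0 <= p n <= 1) ->
  (\forall n \near \oo%classic, 7 * G%:R ^+ 2 / n%:R <= p n) ->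
  (\forall n \near \oo%classic, forall E : {set {set 'I_n}}, E \subset pairs 'I_n ->
     dense_edges G E -> Q n (graph_of_pairs E)) ->
  whp p Q.
Proof.
move=> G0 p01 hp hQ; rewrite /whp.
apply: (@squeeze_cvgr _ _ _ _ (fun n => 1 - 2^-1 ^+ n) (fun=> 1)).
- near=> n; apply/andP; split; last exact: gnp_prob_le1.
  apply: (@gnp_prob_ge _ G) => //; last by near: n; apply: hQ.
  have n0 : 0 < n%:R :> R by rewrite ltr0n; near: n; apply: nbhs_infty_gt.
  by rewrite -ler_pdivrMl // mulrC; near: n; apply: hp.
- rewrite -[X in (_ --> X)%classic]subr0; apply: cvgB; first exact: cvg_cst.
  by apply: cvg_expr; rewrite ger0_norm ?invr_ge0 // invf_lt1 // ltr1n.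
- exact: cvg_cst.
Unshelve. all: by end_near. Qed.

(** * From cycles as sequences to monochromatic copies *)

Lemma cycle_nth (T : Type) (e : rel T) (x0 : T) (cy : seq T) (i : nat) :
  cycle e cy -> (i < size cy)%N ->
  e (nth x0 cy i) (nth x0 cy (i.+1 %% size cy)).
Proof.
case: cy => // x p /(pathP x0) h ip.
have := h i; rewrite size_rcons => /(_ ip); rewrite nth_rcons.
have -> : nth x0 (x :: rcons p x) i = nth x0 (x :: p) i.
  by case: i ip {h} => //= i; rewrite ltnS nth_rcons => ->.
move: ip; rewrite ltnS leq_eqVlt => /predU1P[->|ip].
  by rewrite ltnn eqxx modnn.
by rewrite ip modn_small.
Qed.

Lemma mono_copy_cycle (r : nat) (G : graph) (c : {set G} -> 'I_r) (i : 'I_r)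
    (e : rel G) (cy : seq G) :
  (forall x y, e x y -> [set x; y] \in edges G /\ c [set x; y] = i) ->
  uniq cy -> cycle e cy -> (0 < size cy)%N ->
  mono_copy (cycle_graph (size cy)) c i.
Proof.
move=> he ucy ecy scy; have x0 : G by case: cy scy {ucy ecy}.
exists (fun k : 'I_(size cy) => nth x0 cy k); split.
  by move=> k k' /eqP; rewrite nth_uniq // => /eqP; apply: val_inj.
move=> f; rewrite inE => /andP[/imsetP[k _ ->] _].
by rewrite imsetU1 imset_set1; apply: he; apply: cycle_nth.
Qed.

(** The two color classes are taken as relations on the vertices; the color is found before the
    length [t], as [arrows_family] requires. *)
Lemma even_cycles_arrow (q : nat) : (0 < q)%N ->
  exists G n0 : nat, (0 < G)%N /\
    forall (R : realType) (n j : nat) (E : {set {set 'I_n}}) (a b : R),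
    (n0 <= n <= 2 ^ j)%N -> E \subset pairs 'I_n -> dense_edges G E ->
    (2 * j + 6)%:R <= a -> (3 * q)%:R * b <= ((2 * q - 1) * n)%:R ->
    arrows_family 2 (graph_of_pairs E) (even_cycles a b).
Proof.
move=> q0; have [G [n0 [G0 det]]] := even_cycles_two_colors q0.
exists G, n0; split=> // R n j E a b /andP[n0n nj] Ep dE ja bn c.
pose e i x y := ([set x; y] \in E) && (c [set x; y] == i :> 'I_2).
have es i : symmetric (e i) by move=> x y; rewrite /e finset.setUC.
have [|||f fe hf] := det 'I_n (e ord0) (e ord_max) j (es _) (es _); rewrite ?card_ord //.
  move=> X Y dXY nX nY; have [x [y [xX yY xyE]]] := dE X Y dXY nX nY.
  exists x, y; split=> //; rewrite /e xyE /=.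
  by case: (c _) => -[|[|k]] k2.
have [i fi] : exists i, f = e i by case: fe => ->; [exists ord0|exists ord_max].
exists i => _ [t [at_ tb tev ->]].
have tlo : (2 * j + 6 <= t)%N by rewrite -(ler_nat R); apply: le_trans at_.
have thi : (3 * q * t <= (2 * q - 1) * #|'I_n|)%N.
  by rewrite card_ord -(ler_nat R); apply: le_trans bn; rewrite natrM ler_wpM2l.
have [cy [ucy scy ecy]] := hf t tev tlo thi; rewrite -scy.
apply: (@mono_copy_cycle 2 (graph_of_pairs E) c i f cy) => //; last first.
  by rewrite scy; apply: leq_trans tlo; rewrite addn_gt0 orbT.
move=> x y; rewrite fi => /andP[xyE /eqP cxy]; split=> //.
by rewrite inE xyE (fintype.subsetP Ep).
Qed.

(** * Estimates for logarithms and rounding *)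

Lemma ln2_ge_half (R : realType) : 2^-1 <= ln (2 : R).
Proof.
have := @le_ln1Dx R (- 2^-1); rewrite (_ : 1 + - 2^-1 = 2^-1); last by field.
rewrite lnV ?posrE // lerN2; apply; lra.
Qed.

(** As [ln 2] is at least 1/2, the binary logarithm is at most [2 * ln n], and
    [4 * ln n + 8 <= 5 * ln n] once [ln n >= 8]. This fixes the constant 5. *)
Lemma log_bound (R : realType) (n : nat) : expR 8 <= n%:R :> R ->
  (2 * (trunc_log 2 n).+1 + 6)%:R <= 5 * ln n%:R :> R.
Proof.
move=> n8; have n0 : 0 < n%:R :> R by apply: lt_le_trans n8; apply: expR_gt0.
have h8 : 8 <= ln n%:R :> R by rewrite -ler_expR lnK.
have ln2 := ln2_ge_half R.
have kn : (2 ^ trunc_log 2 n <= n)%N by rewrite trunc_logP // -(ltr0n R).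
have h1 : (trunc_log 2 n)%:R * ln 2 <= ln n%:R :> R.
  rewrite mulr_natl -lnXn // ler_ln ?posrE ?exprn_gt0 //.
  by rewrite -natrX ler_nat.
have h2 := ler_wpM2l (ler0n R (trunc_log 2 n)) ln2.
rewrite natrD natrM -natr1; lra.
Qed.

Lemma floor_even_gt (R : realType) (l : R) : 0 <= l -> l - 2 < (floor_even l)%:R.
Proof.
move=> l0; have [_ _ maxl] := floor_evenP l0.
have /andP[lo hi] := @truncn_itv R (l / 2) (divr_ge0 l0 (ler0n R 2)).
have := maxl (2 * Num.truncn (l / 2))%N; rewrite mul2n odd_double => /(_ isT).
rewrite -mul2n natrM => h.
have {}h : (2 * Num.truncn (l / 2) <= floor_even l)%N.
  by apply: h; lra.
move: h; rewrite -(ler_nat R) natrM; rewrite -[X in _ < X]natr1 in hi; lra.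
Qed.

(** With [y] the square root of [n], [ln n = 2 * ln y <= 2 * y], while
    [k * n >= 12 * y >= 10 * y + 2]. The term [- 2] makes room for the rounding of [floor_even]. *)
Lemma ln_le_linear (R : realType) (k : R) : 0 < k ->
  \forall n \near \oo%classic, 5 * ln n%:R <= k * n%:R - 2 :> R.
Proof.
move=> k0; near=> n.
have n1 : 1 <= n%:R :> R by near: n; apply: nbhs_infty_ger.
have nk : (12 / k) ^+ 2 <= n%:R :> R by near: n; apply: nbhs_infty_ger.
pose y : R := Num.sqrt n%:R.
have y2 : n%:R = y ^+ 2 by rewrite sqr_sqrtr //; lra.
have y1 : 1 <= y by rewrite -(sqrtr1 R) ler_wsqrtr.
have yk : 12 <= k * y.
  rewrite mulrC -ler_pdivrMr // -(@ler_pXn2r _ 2) // ?nnegrE ?divr_ge0 ?(ltW k0) //.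
    by rewrite -y2.
  exact: sqrtr_ge0.
have := @ln_sublinear R y; rewrite y2 lnXn; last by lra.
rewrite -mulr_natl => h; have {}h : ln y < y by apply: h; lra.
nra.
Unshelve. all: by end_near. Qed.

Theorem theorem7p2 (R : realType) :
  exists A : R, 0 < A /\
    forall beta : R, 0 < beta ->
      exists C : R, 0 < C /\
        forall p : nat -> R,
          (forall n, 0 <= p n <= 1) ->
          (\forall n \near \oo%classic, C / n%:R <= p n) ->
          whp p (fun n G =>
            arrows_family 2 G
              (even_cycles (A * ln n%:R) ((2 / 3 - beta) * n%:R)))
          /\
          (beta < 2 / 3 ->
           whp p (fun n G =>
             arrows 2 G (cycle_graph (floor_even ((2 / 3 - beta) * n%:R))))).
Proof.
exists 5; split=> // beta beta0.
(* Then [1 / (3 q) <= beta], so lengths up to [(2 / 3 - beta) * n] are within reach of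
   [even_cycles_arrow]. *)
pose q := (Num.truncn beta^-1).+1.
have q0 : (0 < q)%N by [].
have bq : 1 <= q%:R * beta.
  have bV : 0 <= beta^-1 by rewrite invr_ge0 ltW.
  have /andP[_ h] := truncn_itv bV.
  by rewrite -ler_pdivrMr // div1r ltW // /q.
have [G [n0 [G0 main]]] := even_cycles_arrow q0.
exists (7 * G%:R ^+ 2); split; first by rewrite mulr_gt0 // exprn_gt0 // ltr0n.
move=> p p01 hp.
have family : \forall n \near \oo%classic, forall E : {set {set 'I_n}},
    E \subset pairs 'I_n -> dense_edges G E -> arrows_family 2 (graph_of_pairs E)
      (even_cycles (5 * ln n%:R) ((2 / 3 - beta) * n%:R)).
  near=> n => E Ep dE; apply: (main R n (trunc_log 2 n).+1) => //.
  - apply/andP; split; first by near: n; apply: nbhs_infty_ge.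
    by rewrite ltnW // trunc_log_ltn.
  - by apply: log_bound; near: n; apply: nbhs_infty_ger.
  - rewrite mulrA [leRHS]natrM ler_wpM2r // natrB ?muln_gt0 ?q0 // !natrM.
    by lra.
split; first exact: whp_of_dense_edges hp family.
move=> beta23; apply: whp_of_dense_edges hp _ => //.
have kb : 0 < 2 / 3 - beta by rewrite subr_gt0.
near=> n => E Ep dE c.
have [i hi] : exists i : 'I_2, forall H : graph,
    even_cycles (5 * ln n%:R) ((2 / 3 - beta) * n%:R) H -> mono_copy H c i.
  by have := near family n; apply.
have l0 : 0 <= (2 / 3 - beta) * n%:R by rewrite mulr_ge0 // ltW.
have [ev le_l _] := floor_evenP l0.
exists i; apply: hi; exists (floor_even ((2 / 3 - beta) * n%:R)); split=> //.
(* Rounding loses less than 2, so for large [n] the length is at least [5 * ln n] and the cycle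
   belongs to the family. *)
apply: le_trans (ltW (floor_even_gt l0)).
by near: n; apply: ln_le_linear.
Unshelve. all: by end_near. Qed.
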